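(* Let $X$ be an affine scheme of finite type over $k$ and $\mathfrak{v}\subseteq \operatorname{Vect}(X)$ a Lie subalgebra. Suppose that for every integer $i\ge 0$, the locus of points $x\in X$ at which the evaluation $\mathfrak{v}|_x\subseteq T_xX_{\mathrm{red}}$ has dimension $\le i$ has dimension at most $i$. Then the coinvariant space $(\mathcal{O}_X)_{\mathfrak{v}}=\mathcal{O}_X/\mathfrak{v}(\mathcal{O}_X)$ is finite-dimensional.
   Context: $k$ is an algebraically closed field of characteristic zero; points of $X$ are closed points. $\operatorname{Vect}(X)$ is the Lie algebra of $k$-linear derivations of $\mathcal{O}_X$ (vector fields). Every vector field is tangent to $X_{\mathrm{red}}$, so for $x\in X$ the evaluation $\mathfrak{v}|_x=\{\xi|_x:\xi\in\mathfrak{v}\}$ is a subspace of $T_xX_{\mathrm{red}}$. $\mathfrak{v}(\mathcal{O}_X)$ denotes the $k$-span of all $\xi(f)$, $\xi\in\mathfrak{v}$, $f\in\mathcal{O}_X$. *)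

(* Defs.v *)
From HB Require Import structures.
From mathcomp Require Import all_boot all_order all_algebra.
Set Implicit Arguments. Unset Strict Implicit. Unset Printing Implicit Defensive.
Import GRing.Theory.
Local Open Scope ring_scope.

Section Defs.
Variables (k : closedFieldType) (A : comAlgType k).

Inductive gen_by (s : seq A) : A -> Prop :=
| gen_const c : gen_by s (c%:A)
| gen_mem a : a \in s -> gen_by s a
| gen_add a b : gen_by s a -> gen_by s b -> gen_by s (a + b)
| gen_mul a b : gen_by s a -> gen_by s b -> gen_by s (a * b).

Definition finite_type : Prop := exists s : seq A, forall a, gen_by s a.

(* closed points of X = Spec A, identified with k-algebra maps A -> k *)
Definition is_point (x : A -> k) : Prop :=
  [/\ forall a b, x (a + b) = x a + x b,
      forall a b, x (a * b) = x a * x b,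
      forall (c : k) a, x (c *: a) = c * x a & x 1 = 1].

(* vector fields = k-linear derivations of A *)
Definition is_derivation (xi : A -> A) : Prop :=
  [/\ forall a b, xi (a + b) = xi a + xi b,
      forall (c : k) a, xi (c *: a) = c *: xi a &
      forall a b, xi (a * b) = a * xi b + b * xi a].

Definition lie_bracket (xi eta : A -> A) : A -> A :=
  fun a => xi (eta a) - eta (xi a).

Definition lie_subalgebra (v : (A -> A) -> Prop) : Prop :=
  [/\ forall xi, v xi -> is_derivation xi,
      v (fun _ => 0),
      forall xi eta, v xi -> v eta -> v (fun a => xi a + eta a),
      forall (c : k) xi, v xi -> v (fun a => c *: xi a) &
      forall xi eta, v xi -> v eta -> v (lie_bracket xi eta)].

(* dim (v|_x) <= i, where xi|_x is the tangent vector f |-> x (xi f) *)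
Definition eval_dim_le (v : (A -> A) -> Prop) (x : A -> k) (i : nat) : Prop :=
  exists xis : 'I_i -> (A -> A), (forall j, v (xis j)) /\
    forall xi, v xi -> exists c : 'I_i -> k,
      forall f, x (xi f) = \sum_(j < i) c j * x (xis j f).

Definition prime_ideal (P : A -> Prop) : Prop :=
  [/\ P 0, forall a b, P a -> P b -> P (a + b),
      forall a b, P b -> P (a * b), ~ P 1 &
      forall a b, P (a * b) -> P a \/ P b].

Definition vanishing_ideal (S : (A -> k) -> Prop) : A -> Prop :=
  fun f => forall x, S x -> x f = 0.

(* dim S <= i : Krull dimension of the Zariski closure of S, i.e. of
   A / I(S), is at most i (empty set has dimension -oo). *)
Definition set_dim_le (S : (A -> k) -> Prop) (i : nat) : Prop :=
  forall (m : nat) (p : nat -> A -> Prop),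
    (forall j, (j <= m)%N -> prime_ideal (p j) /\
        forall f, vanishing_ideal S f -> p j f) ->
    (forall j, (j < m)%N -> (forall f, p j f -> p j.+1 f) /\
        exists f, p j.+1 f /\ ~ p j f) ->
    (m <= i)%N.

Definition vO (v : (A -> A) -> Prop) (a : A) : Prop :=
  exists n (c : 'I_n -> k) (xis : 'I_n -> A -> A) (fs : 'I_n -> A),
    (forall j, v (xis j)) /\ a = \sum_(j < n) c j *: xis j (fs j).

Definition coinvariants_findim (v : (A -> A) -> Prop) : Prop :=
  exists m (e : 'I_m -> A), forall a, exists c : 'I_m -> k,
    vO v (a - \sum_(j < m) c j *: e j).

End Defs.

(* Main.v *)
Require Import Defs.
From HB Require Import structures.
From mathcomp Require Import all_boot all_order all_algebra.
From mathcomp.multinomials Require Import mpoly.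
From mathcomp Require boolp classical_sets.
From mathcomp Require Import zify ring.
Set Implicit Arguments. Unset Strict Implicit. Unset Printing Implicit Defensive.
Import GRing.Theory.
Local Open Scope ring_scope.

(** Write A as a quotient of k[x_1..x_n] and let M be the quotient of the Weyl
    algebra by the right ideal generated by the equations of A and by the vector
    fields in v, so that the coinvariants are M / sum_i M d_i.

    Lower bound. In characteristic zero, if m d_i^a = 0 in a right module then m
    lies in the image of d_i; hence h elements of A independent modulo v(A) give
    h (t+1)^n independent elements m d^alpha of M, with alpha in [0,t]^n.

    Upper bound. The images of the n+1 element subsets of the 2n coordinates
    x_i, xi_i of the cotangent space are algebraically dependent on the common
    zero locus of the symbols of v, because over a point where v has rank r this
    locus has fibre dimension n - r. The leading monomials of finitely many such
    dependence relations, with the weights 1 for x_i and a large N for d_i, leave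
    only O(t^n) standard monomials of weight at most t, and these span M up to
    weight t. Comparing the two bounds limits h.

    The dependence relations are found as follows. Otherwise a prime Q over the
    symbol ideal avoids k[U]\0 for some U of size n+1. Let P be its contraction
    to A and r the rank of v over A/P. By the Nullstellensatz every function
    vanishing where v has rank at most r lies in P, so A/P has dimension at most
    r by hypothesis; counting monomials shows that U is dependent modulo Q. *)

(** * Algebraic and integral elements over a domain *)

Definition algebraic_in (C K : nzRingType) (psi : C -> K) (y : K) :=
  exists2 p : {poly C}, p != 0 & root (map_poly psi p) y.

Lemma map_poly_neq0 (C C' : nzRingType) (f : {rmorphism C -> C'})
  (p : {poly C}) : injective f -> p != 0 -> map_poly f p != 0.
Proof.
move=> fI; apply: contra_neq => /polyP fp; apply/polyP => i.
by apply: fI; rewrite -coef_map fp !coef0 rmorph0.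
Qed.

(** Run through [ys] and adjoin as a new polynomial variable each element not algebraic over the
    ring reached so far. The last clause survives because divisors of a nonzero constant polynomial
    over a domain are constant. *)
Lemma algebraic_tower (K : comNzRingType) (ys : seq K) (C : idomainType)
    (psi : {rmorphism C -> K}) : injective psi ->
  exists (C' : idomainType) (psi' : {rmorphism C' -> K})
         (iota : {rmorphism C -> C'}),
    [/\ injective psi', forall c, psi' (iota c) = psi c,
        forall y, y \in ys -> algebraic_in psi' y &
        forall (c : C) b d, c != 0 -> b * d = iota c -> exists b0, b = iota b0].
Proof.
elim: ys C psi => [|y ys IH] C psi psiI.
  exists C, psi, idfun; split=> // c b d _ _; by exists b.
case: (boolp.EM (algebraic_in psi y)) => [[p p0 py]|nalg].
  have [C' [psi' [iota [psi'I psi'E alg div]]]] := IH _ _ psiI.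
  exists C', psi', iota; split=> // z; rewrite inE => /orP[/eqP->|]; last exact: alg.
  exists (map_poly iota p); last first.
    by rewrite -map_poly_comp (eq_map_poly psi'E).
  by apply: map_poly_neq0 => // a b /(congr1 psi'); rewrite !psi'E => /psiI.
have cy : commr_rmorph psi y by move=> c; apply: mulrC.
pose psi1 : {rmorphism {poly C} -> K} := horner_morph cy.
have psi1I : injective psi1.
  apply: raddf_inj => p py; apply/eqP/negP => /negP p0; apply: nalg.
  by exists p; rewrite // /root; apply/eqP.
have [C' [psi' [iota [psi'I psi'E alg div]]]] := IH _ _ psi1I.
have iotaI : injective iota.
  by move=> a b /(congr1 psi'); rewrite !psi'E => /psi1I.
exists C', psi', (iota \o polyC); split=> //.
- by move=> c /=; rewrite psi'E /psi1 /= horner_morphC.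
- move=> z; rewrite inE => /orP[/eqP->|]; last exact: alg.
  exists ('X - (iota 'X)%:P); first by rewrite polyXsubC_eq0.
  by rewrite map_polyXsubC root_XsubC psi'E /psi1 /= horner_morphX.
move=> c b d c0 bd.
have c0' : c%:P != 0 by rewrite polyC_eq0.
have [b0 b0E] := div _ _ _ c0' bd.
have [d0 d0E] := div _ _ _ c0' (etrans (mulrC d b) bd).
have bdE : b0 * d0 = c%:P by apply: iotaI; rewrite rmorphM -b0E -d0E.
have : (size b0 <= 1)%N.
  have b00 : b0 != 0 by apply: contraNneq c0' => b00; rewrite -bdE b00 mul0r.
  have d00 : d0 != 0 by apply: contraNneq c0' => d00; rewrite -bdE d00 mulr0.
  have := size_mul b00 d00; rewrite bdE size_polyC c0.
  have := size_poly_gt0 d0; rewrite d00; lia.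
by move/size1_polyC => b0C; exists b0`_0 => /=; rewrite b0E b0C coefC.
Qed.

(** With [s] the leading coefficient and [q] the degree of the equation, multiplying by [s ^+ q.-1]
    makes it a monic equation for [s * y]. *)
Lemma algebraic_integral_scale (C : idomainType) (K : comNzRingType)
    (psi : {rmorphism C -> K}) (y : K) : injective psi ->
  algebraic_in psi y -> exists2 s, s != 0 & integralOver psi (psi s * y).
Proof.
move=> psiI [p p0 py].
have sp : size p = (size p).-1.+1 by rewrite prednK // size_poly_gt0.
case: (posnP (size p).-1) => [sp0|].
  have /size1_polyC pC : (size p <= 1)%N by lia.
  have : p`_0 == 0.
    by move: py; rewrite {1}pC map_polyC /root hornerC raddf_eq0.
  by move: p0; rewrite {1}pC polyC_eq0 => /negPf->.
set q := (size p).-1 => q0.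
pose s := lead_coef p.
exists s; first by rewrite lead_coef_eq0.
pose f := \poly_(j < q) (p`_j * s ^+ (q.-1 - j)) + 'X^q.
have sf : (size (\poly_(j < q) (p`_j * s ^+ (q.-1 - j)))%R
           < size ('X^q : {poly C})%R)%N.
  by rewrite size_polyXn ltnS size_poly.
exists f; first by rewrite monicE /f lead_coefDr // lead_coefXn.
have psf : map_poly psi f = \poly_(j < q) (psi (p`_j * s ^+ (q.-1 - j))) + 'X^q.
  rewrite rmorphD /= map_polyXn; congr (_ + _); apply/polyP => i.
  by rewrite coef_map /= !coef_poly; case: ifP => // _; rewrite raddf0.
rewrite /root psf hornerD hornerXn horner_poly.
have : (map_poly psi p).[y] = 0 by apply/eqP.
rewrite (horner_coef_wide _ (n := q.+1)); last first.
  by rewrite /q -sp; apply: size_poly.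
rewrite big_ord_recr /= coef_map => py'.
rewrite (eq_bigr (fun j : 'I_q => psi s ^+ q.-1 * ((map_poly psi p)`_j * y ^+ j))).
  rewrite -mulr_sumr exprMn -[in psi s ^+ q](prednK q0) exprSr -mulrA -mulrDr /= .
  by rewrite -[psi s]/(psi p`_q) py' mulr0.
move=> j _; rewrite rmorphM rmorphXn coef_map exprMn /=.
have -> : psi s ^+ q.-1 = psi s ^+ (q.-1 - j) * psi s ^+ j.
  by rewrite -exprD; congr (_ ^+ _); have := ltn_ord j; lia.
by ring.
Qed.

(** The constant term of an equation for [y] is a multiple of [y]. If it is zero, a factor ['X] can
    be removed, since [y] is nonzero and [K] has no zero divisors. *)
Lemma algebraic_dvd_base (C : idomainType) (K : comNzRingType)
    (psi : {rmorphism C -> K}) (y : K) :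
  (forall a b : K, a * b = 0 -> a = 0 \/ b = 0) ->
  injective psi -> y != 0 -> algebraic_in psi y ->
  exists2 g, g != 0 & exists a, psi g = a * y.
Proof.
move=> Kdom psiI y0 [p p0 py].
move: {2}(size p) (leqnn (size p)) => m; elim: m p p0 py => [|m IH] p p0 py.
  by rewrite leqn0 size_poly_eq0 (negPf p0).
move=> sp.
have pE : p = Poly (behead p) * 'X + (p`_0)%:P.
  apply/polyP => i; rewrite coefD coefMX coefC coef_Poly nth_behead.
  by case: i => [|i]; rewrite /= ?add0r ?addr0.
set p1 := Poly (behead p) in pE.
have py0 : (map_poly psi p1).[y] * y + psi p`_0 = 0.
  by move/eqP: py; rewrite {1}pE rmorphD rmorphM /= map_polyX map_polyC !hornerE.
case: (eqVneq p`_0 0) => [p00|p00].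
  have p10 : p1 != 0 by apply: contraNneq p0 => p10; rewrite pE p10 p00 mul0r add0r.
  apply: (IH p1) => //; last first.
    by apply: leq_trans (size_Poly _) _; rewrite size_behead; lia.
  move: py0; rewrite p00 rmorph0 addr0 => /Kdom[/eqP//|/eqP].
  by rewrite (negPf y0).
exists p`_0 => //; exists (- (map_poly psi p1).[y]).
by apply/eqP; rewrite -subr_eq0 mulNr opprK addrC py0.
Qed.

Inductive gen_over (C K : nzRingType) (psi : C -> K) (s : seq K) : K -> Prop :=
| gen_over_base c : gen_over psi s (psi c)
| gen_over_mem a : a \in s -> gen_over psi s a
| gen_over_add a b : gen_over psi s a -> gen_over psi s b -> gen_over psi s (a + b)
| gen_over_mul a b : gen_over psi s a -> gen_over psi s b -> gen_over psi s (a * b).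

(** Multiply the monic equation of degree [q] for [w] by [psi b ^+ q]: every term except [z ^+ q]
    then keeps a factor [b]. *)
Lemma integral_fraction (C : idomainType) (K : comNzRingType)
    (psi : {rmorphism C -> K}) (w : K) (b z : C) : injective psi ->
  integralOver psi w -> w * psi b = psi z -> exists m d, z ^+ m = b * d.
Proof.
move=> psiI [p mp pw] wb.
pose q := (size p).-1.
have sp : size p = q.+1 by rewrite prednK // size_poly_gt0 monic_neq0.
exists q, (- \sum_(j < q) p`_j * z ^+ j * b ^+ (q.-1 - j)).
apply: psiI; apply/eqP; rewrite mulrN rmorphN -subr_eq0 opprK addrC; apply/eqP.
have : (map_poly psi p).[w] * psi b ^+ q = 0 by move/eqP: pw => ->; rewrite mul0r.
rewrite (horner_coef_wide _ (n := q.+1)); last by rewrite -sp size_poly.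
rewrite big_ord_recr /= coef_map.
have -> : p`_q = 1 by apply/eqP; rewrite -[_ == _]monicE.
rewrite /= rmorph1 mul1r mulrDl -exprMn wb mulr_suml => <-.
congr (_ + _); last by rewrite rmorphXn.
rewrite mulr_sumr rmorph_sum; apply: eq_bigr => j _.
rewrite coef_map !rmorphM !rmorphXn /= -wb.
have -> : psi b ^+ q = psi b * psi b ^+ (q.-1 - j) * psi b ^+ j.
  by rewrite -exprS -exprD; congr (_ ^+ _); have := ltn_ord j; lia.
by rewrite exprMn; ring.
Qed.

(* If some nonzero multiple of every [b] were of the form [psi c * f ^+ M], then
   so for [b = 1 + u s g], where [u] is the transcendental element [psi 'X] and
   [s], [g] are denominators for the generators and for [f]; as [b] is coprime to
   [s g], integrality would make [b] divide a power of some [c]; but [b] involves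
   [u] and [c] does not. *)
Lemma transcendental_not_unit (K : comNzRingType) (ys : seq K) (C : idomainType)
    (psi : {rmorphism {poly C} -> K}) (f : K) :
  (forall a b : K, a * b = 0 -> a = 0 \/ b = 0) ->
  injective psi -> f != 0 -> (forall a, gen_over psi ys a) ->
  exists2 b : K, b != 0 &
    forall a (c : C) M, c != 0 -> a * b <> psi c%:P * f ^+ M.
Proof.
move=> Kdom psiI f0 gen.
have [C' [psi' [iota [psi'I psi'E alg div]]]] := algebraic_tower (f :: ys) psiI.
have iotaI : injective iota.
  by move=> a b /(congr1 psi'); rewrite !psi'E => /psiI.
have [g g0 [f' gE]] := algebraic_dvd_base Kdom psi'I f0 (alg f (mem_head _ _)).
have [s s0 int_s] : exists2 s, s != 0 & forall y, y \in ys -> integralOver psi' (psi' s * y).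
  have {}alg y : y \in ys -> algebraic_in psi' y.
    by move=> yys; apply: alg; rewrite inE yys orbT.
  elim: ys alg {gen} => [|y ys IH] alg; first by exists 1; rewrite ?oner_neq0.
  have [|s s0 sP] := IH; first by move=> z zys; apply: alg; rewrite inE zys orbT.
  have [s1 s10 s1P] := algebraic_integral_scale psi'I (alg y (mem_head _ _)).
  exists (s * s1) => [|z]; first by rewrite mulf_neq0.
  rewrite inE rmorphM => /orP[/eqP->|zys].
    by rewrite -mulrA; apply: integral_mul => //; apply: integral_id.
  by rewrite mulrAC; apply: integral_mul; [apply: sP|apply: integral_id].
have int_all a : exists D, integralOver psi' (psi' s ^+ D * a).
  elim: {a}(gen a) => [c|a ays|a b _ [D1 h1] _ [D2 h2]|a b _ [D1 h1] _ [D2 h2]].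
  - by exists 0%N; rewrite mul1r -psi'E; apply: integral_id.
  - by exists 1%N; rewrite expr1; apply: int_s.
  - exists (D1 + D2)%N.
    have -> : psi' s ^+ (D1 + D2) * (a + b) =
              psi' (s ^+ D2) * (psi' s ^+ D1 * a) + psi' (s ^+ D1) * (psi' s ^+ D2 * b).
      by rewrite !rmorphXn exprD; ring.
    by apply: integral_add; apply: integral_mul => //; apply: integral_id.
  - exists (D1 + D2)%N.
    have -> : psi' s ^+ (D1 + D2) * (a * b) = (psi' s ^+ D1 * a) * (psi' s ^+ D2 * b).
      by rewrite exprD; ring.
    by apply: integral_mul.
pose u := iota 'X.
have u0 : u != 0 by rewrite /u raddf_eq0 // polyX_eq0.
pose b := 1 + u * (s * g).
(* [b] divides no nonzero constant: by the divisor property of [iota] it would come from some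
   [1 + 'X * t] with [t] nonzero, which has positive degree. *)
have key (c : {poly C}) d : c != 0 -> (size c <= 1)%N -> b * d <> iota c.
  move=> c0 sc bd.
  have [b0 b0E] := div _ _ _ c0 bd.
  have [d0 d0E] := div _ _ _ c0 (etrans (mulrC _ _) bd).
  have b1 : u * (s * g) = iota (b0 - 1) by rewrite rmorphB rmorph1 -b0E /b addrC addKr.
  have b10 : b0 - 1 != 0.
    apply: contraTneq (mulf_neq0 u0 (mulf_neq0 s0 g0)) => b10.
    by rewrite b1 b10 rmorph0 eqxx.
  have [t tE] := div _ _ _ b10 (etrans (mulrC _ _) b1).
  have b0X : b0 = 1 + 'X * t by apply: iotaI; rewrite rmorphD rmorph1 rmorphM -tE -b0E.
  have t0 : t != 0 by apply: contraNneq (mulf_neq0 s0 g0); rewrite tE => ->; rewrite rmorph0.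
  have cE : b0 * d0 = c by apply: iotaI; rewrite rmorphM -b0E -d0E.
  have d00 : d0 != 0 by apply: contraNneq c0 => d00; rewrite -cE d00 mulr0.
  have sb0 : (size b0 > 1)%N.
    have sXt : size ('X * t) = (size t).+1 by rewrite mulrC size_mulX.
    have := size_poly_gt0 t; rewrite t0 => st.
    by rewrite b0X addrC size_polyDl ?sXt ?size_poly1.
  have b00 : b0 != 0 by rewrite -size_poly_gt0; apply: ltn_trans sb0.
  by move: sc; rewrite -cE size_mul //; have := size_poly_gt0 d0; rewrite d00; lia.
have b0 : b != 0.
  apply/eqP => b0.
  have e : u * (s * g) = iota (-1).
    by rewrite rmorphN rmorph1; apply/eqP; rewrite -subr_eq0 opprK addrC -b0.
  have m10 : -1 != 0 :> {poly C} by rewrite oppr_eq0 oner_eq0.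
  have [t tE] := div _ _ _ m10 (etrans (mulrC _ _) e).
  have : 'X * t = -1 by apply: iotaI; rewrite rmorphM -tE e.
  move/(congr1 (fun p => p.[0])); rewrite !hornerE => /eqP.
  by rewrite eq_sym oppr_eq0 oner_eq0.
exists (psi' b) => [|a c M c0 ab]; first by rewrite raddf_eq0.
(* [s ^+ D] clears the denominators of [a * f' ^+ M]; since [g] is [f' * f], the product with [b]
   lies in the base. *)
have [D intD] := int_all (a * f' ^+ M).
have wb : psi' s ^+ D * (a * f' ^+ M) * psi' b = psi' (s ^+ D * (iota c%:P * g ^+ M)).
  rewrite !rmorphM !rmorphXn /= psi'E gE exprMn.
  transitivity (psi' s ^+ D * (a * psi' b) * f' ^+ M); first by ring.
  by rewrite ab; ring.
have [m [d dE]] := integral_fraction psi'I intD wb.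
(* At this exponent the [m]-th power can be completed to [(s * g) ^+ L] times the power of [c]. *)
pose L := ((D + M) * m)%N.
have [d1 d1E] : exists d1, (s * g) ^+ L * iota (c%:P ^+ m) = b * d1.
  exists (g ^+ (D * m) * s ^+ (M * m) * d).
  rewrite mulrCA -dE !exprMn !rmorphXn /L mulnDl !exprD -!exprM; ring.
(* Modulo [b] the element [u * (s * g)] is -1, so multiplying by [u ^+ L] removes the power of
   [s * g]. *)
have [h hE] : exists h, (u * (s * g)) ^+ L = (-1) ^+ L + b * h.
  have -> : u * (s * g) = b - 1 by rewrite /b addrC addKr.
  elim: L {d1E} => [|L [h hE]]; first by exists 0; rewrite mulr0 addr0.
  exists (h * (b - 1) + (-1) ^+ L).
  rewrite exprSr hE exprS; move: ((-1) ^+ L) => e; ring.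
apply: (key (c%:P ^+ m) ((-1) ^+ L * (u ^+ L * d1 - h * iota (c%:P ^+ m)))).
- by rewrite expf_neq0 // polyC_eq0.
- by rewrite -rmorphXn size_polyC; case: (_ != 0).
have h1 : u ^+ L * (b * d1) = ((-1) ^+ L + b * h) * iota (c%:P ^+ m).
  by rewrite -d1E -hE mulrA -exprMn.
transitivity ((-1) ^+ L * (u ^+ L * (b * d1) - b * h * iota (c%:P ^+ m))); first by ring.
rewrite h1; transitivity (((-1) ^+ L * (-1) ^+ L) * iota (c%:P ^+ m)); first by ring.
by rewrite -exprMn mulrNN mulr1 expr1n mul1r.
Qed.

(** * Prime ideals, their quotients and the Nullstellensatz *)

Section PrimeIdeals.
Variables (k : closedFieldType) (A : comAlgType k).
Implicit Types (I S P : A -> Prop) (a b f : A).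

Definition is_ideal I :=
  [/\ I 0, forall a b, I a -> I b -> I (a + b) & forall a b, I b -> I (a * b)].

Lemma prime_is_ideal P : prime_ideal P -> is_ideal P.
Proof. by case. Qed.

Lemma ideal_opp I a : is_ideal I -> I a -> I (- a).
Proof. by case=> _ _ IM Ia; rewrite -mulN1r; apply: IM. Qed.

Lemma ideal_sub I a b : is_ideal I -> I a -> I b -> I (a - b).
Proof. by move=> idI; case: (idI) => _ ID _ Ia Ib; apply: ID => //; apply: ideal_opp. Qed.

(** An ideal maximal among those containing [I] and disjoint from a multiplicative set is prime. The
    last clause records maximality for use in the Nullstellensatz. *)
Lemma prime_avoiding I S : is_ideal I -> S 1 ->
    (forall a b, S a -> S b -> S (a * b)) -> (forall a, I a -> ~ S a) ->
  exists P, [/\ prime_ideal P, forall a, I a -> P a, forall a, P a -> ~ S a &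
    forall b, ~ P b -> exists p a, P p /\ S (p + a * b)].
Proof.
move=> idI S1 SM IS.
pose good (X : A -> Prop) := [/\ is_ideal X, forall a, I a -> X a & forall a, X a -> ~ S a].
have [|P [Pgood Pmax]] := @classical_sets.Zorn_bigcup A (fun X => (forall a, ~ X a) \/ good X).
  move=> F Fgood Ftot.
  case: (boolp.EM (exists X a, F X /\ X a)) => [[X [a [FX Xa]]]|nF]; last first.
    by left=> a [X FX Xa]; apply: nF; exists X, a.
  have goodF Y b : F Y -> Y b -> good Y by move=> FY Yb; case: (Fgood Y FY) => // /(_ b).
  have [[X0 _ _] IX _] := goodF _ _ FX Xa.
  right; split; first split.
  - by exists X.
  - move=> b c [Y FY Yb] [Z FZ Zc].
    have [[_ YD _] _ _] := goodF _ _ FY Yb.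
    have [[_ ZD _] _ _] := goodF _ _ FZ Zc.
    by case: (Ftot _ _ FY FZ) => sub; [exists Z|exists Y] => //=;
      [apply: ZD => //; apply: sub|apply: YD => //; apply: sub].
  - move=> b c [Y FY Yc]; have [[_ _ YM] _ _] := goodF _ _ FY Yc.
    by exists Y => //; apply: YM.
  - by move=> b Ib; exists X => //; apply: IX.
  - by move=> b [Y FY Yb]; have [_ _] := goodF _ _ FY Yb; apply.
have {Pgood} [idP IP PS] : good P.
  case: Pgood => // P0; exfalso; apply: (Pmax I); last by right.
  split; first by move=> a /P0.
  by move/(_ 0) => /= h; case: idI => I0 _ _; apply: (P0 0); apply: h.
have [P0 PD PM] := idP.
have ext b : ~ P b -> exists p a, P p /\ S (p + a * b).
  move=> Pb; apply: boolp.contrapT => nex.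
  apply: (Pmax (fun c => exists p a, P p /\ c = p + a * b)).
    split=> [c Pc|]; first by exists c, 0; rewrite mul0r addr0.
    by move/(_ b) => /= h; apply/Pb/h; exists 0, 1; rewrite mul1r add0r.
  right; split; first split.
  - by exists 0, 0; rewrite mul0r addr0.
  - move=> _ _ [p [a [Pp ->]]] [p' [a' [Pp' ->]]].
    by exists (p + p'), (a + a'); split; [exact: PD|ring].
  - move=> c _ [p [a [Pp ->]]]; exists (c * p), (c * a); split; [exact: PM|ring].
  - by move=> a Ia; exists a, 0; rewrite mul0r addr0; split=> //; apply: IP.
  - by move=> _ [p [a [Pp ->]]] Sp; apply: nex; exists p, a.
exists P; split=> //; split=> //; first by move=> P1; exact: (PS 1).
move=> a b Pab; apply: boolp.contrapT => /boolp.not_orP[Pa Pb].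
have [p [c [Pp Sp]]] := ext _ Pa; have [q [d [Pq Sq]]] := ext _ Pb.
apply: (PS ((p + c * a) * (q + d * b))); last exact: SM.
have -> : (p + c * a) * (q + d * b) = (q + d * b) * p + (c * a) * q + (c * d) * (a * b) by ring.
by apply: (PD); first apply: (PD); apply: PM.
Qed.

Lemma prime_powers P f i : prime_ideal P -> ~ P f -> ~ P (f ^+ i).
Proof.
case=> _ _ _ P1 PM Pf; elim: i => [|i IH]; first by rewrite expr0.
by rewrite exprS => /PM[].
Qed.

Section Quotient.
Variables (P : A -> Prop) (prP : prime_ideal P).

Definition prime_pred : {pred A} := fun a => boolp.asbool (P a).

Fact prime_pred_idealr : idealr_closed prime_pred.
Proof.
case: prP => P0 PD PM P1 _; split; [exact/boolp.asboolP|exact/boolp.asboolP|].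
move=> a b c /boolp.asboolP Pb /boolp.asboolP Pc; apply/boolp.asboolP.
exact/PD/Pc/PM.
Qed.

HB.instance Definition _ := isIdealr.Build A prime_pred prime_pred_idealr.

Lemma prime_quotient :
  exists (K : comNzRingType) (phi : {rmorphism A -> K}),
    [/\ forall a, phi a = 0 <-> P a, forall y, exists a, y = phi a &
        forall x y : K, x * y = 0 -> x = 0 \/ y = 0].
Proof.
pose K : comNzRingType := {ideal_quot prime_pred}.
pose f : {rmorphism A -> K} := \pi_K%qT.
have f0 a : f a = 0 <-> P a.
  split=> [/eqP|Pa]; last apply/eqP.
    by rewrite /f piE /= Quotient.equivE subr0 => /boolp.asboolP.
  by rewrite /f piE /= Quotient.equivE subr0; apply/boolp.asboolP.
have fs y : exists a, y = f a by exists (repr y); rewrite /f /= reprK.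
exists K, f; split=> // x y; have [a ->] := fs x; have [b ->] := fs y.
rewrite -rmorphM => /f0; case: prP => _ _ _ _ PM /PM.
by case=> /f0; [left|right].
Qed.

End Quotient.

Hypothesis hft : finite_type A.

Lemma gen_over_quotient (C : nzRingType) (K : nzRingType) (phi : {rmorphism A -> K})
    (psi : {rmorphism C -> K}) s a :
  (forall c : k, exists d, psi d = phi c%:A) -> gen_by s a ->
  gen_over psi (map phi s) (phi a).
Proof.
move=> kC; elim=> [c|b bs|b c _ IHb _ IHc|b c _ IHb _ IHc].
- by have [d <-] := kC c; constructor.
- by apply: gen_over_mem; apply: map_f.
- by rewrite rmorphD; apply: gen_over_add.
- by rewrite rmorphM; apply: gen_over_mul.
Qed.

(** Take [b] nonzero modulo [P] with no multiple congruent to a nonzero element of [C]. The ideal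
    generated by [P] and [b] misses those elements, and so does some prime above it, which is
    strictly larger than [P]. *)
Lemma prime_chain_step P (C : idomainType) (psi : {rmorphism {poly C} -> A}) :
  prime_ideal P -> (forall c : k, exists d, psi d = c%:A) ->
  (forall c, c != 0 -> ~ P (psi c)) ->
  exists P', [/\ prime_ideal P', forall f, P f -> P' f, exists f, P' f /\ ~ P f &
    forall c : C, c != 0 -> ~ P' (psi c%:P)].
Proof.
move=> prP kC ind; have [s gens] := hft.
have [K [phi [phi0 phis Kdom]]] := prime_quotient prP.
pose chi : {rmorphism {poly C} -> K} := phi \o psi.
have [||y|b b0 hb] := @transcendental_not_unit K (map phi s) C chi 1 Kdom.
- apply: raddf_inj => c /= /phi0 Pc; apply/eqP; apply: boolp.contrapT => /negP c0.
  by apply: (ind c).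
- exact: oner_neq0.
- have [a ->] := phis y; apply: gen_over_quotient (gens a) => c.
  by have [d dE] := kC c; exists d; rewrite /chi /= dE.
have [b' bE] := phis b; rewrite {b}bE in b0 hb.
have [P0 PD PM P1 Ppr] := prP.
have [||||P' [prP' IP' P'S _]] :=
  @prime_avoiding (fun c => exists p a, P p /\ c = p + a * b')
     (fun c => exists2 d : C, d != 0 & c = psi d%:P).
- split; first by exists 0, 0; rewrite mul0r addr0.
  + move=> _ _ [p [a [Pp ->]]] [p' [a' [Pp' ->]]].
    by exists (p + p'), (a + a'); split; [exact: PD|ring].
  + move=> c _ [p [a [Pp ->]]]; exists (c * p), (c * a); split; [exact: PM|ring].
- by exists 1; rewrite ?oner_neq0 // rmorph1.
- move=> _ _ [d d0 ->] [e e0 ->]; exists (d * e); first by rewrite mulf_neq0.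
  by rewrite polyCM rmorphM.
- move=> _ [p [a [Pp ->]]] [d d0 /(congr1 phi)].
  rewrite rmorphD rmorphM /= (phi0 p).2 // add0r => e.
  by apply: (hb (phi a) d 0%N d0); rewrite e expr0 mulr1.
exists P'; split=> //.
- by move=> f Pf; apply: IP'; exists f, 0; rewrite mul0r addr0.
- exists b'; split; first by apply: IP'; exists 0, 1; rewrite mul1r add0r.
  by move/phi0 => bb; rewrite bb eqxx in b0.
- by move=> c c0 Pc; apply: (P'S _ Pc); exists c.
Qed.

(** Let [Q] over [P] be maximal among the ideals avoiding the powers of [f]. An element not scalar
    modulo [Q] would be transcendental over [k], and [transcendental_not_unit] would give a [b]
    without multiples among these powers, against maximality. So the quotient by [Q] is [k], and the
    residue map is the point. *)
Lemma nullstellensatz P f : prime_ideal P -> ~ P f ->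
  exists x : A -> k, [/\ is_point x, forall a, P a -> x a = 0 & x f <> 0].
Proof.
move=> prP Pf; have [s gens] := hft.
have [|||Q [prQ PQ QS Qmax]] :=
  @prime_avoiding P (fun a => exists i, a = f ^+ i) (prime_is_ideal prP).
- by exists 0%N.
- by move=> _ _ [i ->] [j ->]; exists (i + j)%N; rewrite exprD.
- by move=> a Pa [i aE]; apply: (prime_powers (i := i) prP Pf); rewrite -aE.
have Qf : ~ Q f by move=> Qf; apply: (QS f Qf); exists 1%N.
have idQ := prime_is_ideal prQ; have [Q0 QD QM Q1 _] := prQ.
have [K [phi [phi0 phis Kdom]]] := prime_quotient prQ.
have scal a : exists l : k, Q (a - l%:A).
  apply: boolp.contrapT => nex.
  pose j : {rmorphism k -> K} := phi \o GRing.in_alg A.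
  have cy : commr_rmorph j (phi a) by move=> c; apply: mulrC.
  pose chi : {rmorphism {poly k} -> K} := horner_morph cy.
  have chi0 p : chi p = 0 -> p = 0.
    apply: contra_eq => p0.
    (* Over the algebraically closed [k] the polynomial splits, and no linear factor [a - z]
       vanishes modulo [Q]. *)
    have [r] := closed_field_poly_normal p.
    have L0 : lead_coef p != 0 by rewrite lead_coef_eq0.
    move: (lead_coef p) L0 => L L0 ->.
    rewrite -mul_polyC rmorphM /=; apply/eqP => /Kdom[|].
      rewrite /chi /= horner_morphC /= => /phi0 QL; apply: Q1.
      have := QM L^-1%:A _ QL.
      by rewrite /= -scalerAl mul1r scalerA mulVf ?scale1r.
    rewrite rmorph_prod; elim: r => [|z r IH].
      by rewrite big_nil => /eqP; rewrite oner_eq0.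
    rewrite big_cons => /Kdom[|]; last exact: IH.
    rewrite rmorphB /chi /= horner_morphX horner_morphC /= -rmorphB => /phi0 Qz.
    by apply: nex; exists z.
  have [||y|b b0 hb] := @transcendental_not_unit K (map phi s) k chi (phi f) Kdom.
  - exact: raddf_inj.
  - by apply/eqP => /phi0.
  - have [c ->] := phis y; apply: gen_over_quotient (gens c) => d.
    by exists d%:P; rewrite /chi /= horner_morphC.
  have [b' bE] := phis b; rewrite {b}bE in b0 hb.
  have Qb' : ~ Q b' by move/phi0 => e; rewrite e eqxx in b0.
  have [p [c [Qp [i pE]]]] := Qmax _ Qb'.
  apply: (hb (phi c) 1 i); first exact: oner_neq0.
  by rewrite rmorph1 mul1r -rmorphM -rmorphXn -pE rmorphD (phi0 p).2 // add0r.
have [x xP] := boolp.choice scal.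
have xE a l : Q (a - l%:A) -> x a = l.
  move=> Ql; apply/eqP; rewrite -subr_eq0; apply: boolp.contrapT => /negP xl.
  apply: Q1; have /(QM ((x a - l)^-1)%:A) := ideal_sub idQ Ql (xP a).
  have -> : a - l%:A - (a - (x a)%:A) = (x a)%:A - l%:A by ring.
  rewrite -scalerBl -scalerAl mul1r scalerA mulVf //.
  by rewrite scale1r.
exists x; split.
- split=> [a b|a b|c a|]; apply: xE.
  + have := QD _ _ (xP a) (xP b); rewrite scalerDl; congr Q; ring.
  + have := QD _ _ (QM b _ (xP a)) (QM (x a)%:A _ (xP b)).
    congr Q; rewrite !mulrBr -!scalerAl !mul1r scalerA -scalerAr mulr1.
    by rewrite (mulrC b a) addrA subrK.
  + have := QM c%:A _ (xP a).
    by rewrite mulrBr -!scalerAl !mul1r scalerA.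
  + by rewrite scale1r subrr.
- by move=> a Pa; apply: xE; rewrite scale0r subr0; apply: PQ.
- by move=> xf; have := xP f; rewrite xf scale0r subr0.
Qed.

End PrimeIdeals.

(** * Iterated polynomial rings and chains of primes *)

Section PolynomialTower.
Variable k : closedFieldType.

(** Iterated univariate polynomials, so that variables can be stripped off one at a time. *)
Fixpoint tower d : idomainType := if d is d'.+1 then {poly tower d'} else k.

Fixpoint tower_eval (A : comAlgType k) (u : nat -> A) d : {rmorphism tower d -> A} :=
  match d with
  | 0%N => GRing.in_alg A
  | d'.+1 => horner_morph (fun c => mulrC (u d') (tower_eval u d' c))
  end.

Lemma tower_evalS (A : comAlgType k) (u : nat -> A) d (p : tower d.+1) :
  tower_eval u d.+1 p = (map_poly (tower_eval u d) (p : {poly tower d})).[u d].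
Proof. by []. Qed.

Lemma tower_eval_const (A : comAlgType k) (u : nat -> A) d (c : k) :
  exists x, tower_eval u d x = c%:A.
Proof.
elim: d => [|d [x xE]]; first by exists c.
by exists (polyC x); rewrite tower_evalS map_polyC hornerC.
Qed.

(** Each use of [prime_chain_step] trades the outermost variable for a strictly larger prime. *)
Lemma prime_chain (A : comAlgType k) (u : nat -> A) d (P : A -> Prop) :
  finite_type A -> prime_ideal P ->
  (forall c, c != 0 -> ~ P (tower_eval u d c)) ->
  exists p : nat -> A -> Prop,
    [/\ forall f, P f -> p 0%N f, forall j, (j <= d)%N -> prime_ideal (p j) &
        forall j, (j < d)%N -> (forall f, p j f -> p j.+1 f) /\
          exists f, p j.+1 f /\ ~ p j f].
Proof.
move=> hft; elim: d P => [|d IH] P prP ind.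
  by exists (fun _ => P); split=> // j; rewrite leqn0 => /eqP->.
have [P' [prP' PP' [f [P'f Pf]] ind']] :=
  @prime_chain_step k A hft P (tower d) (tower_eval u d.+1) prP
    (tower_eval_const u d.+1) ind.
have [|p [p0 pprime pS]] := IH P' prP'.
  by move=> c c0; have := ind' c c0; rewrite tower_evalS map_polyC hornerC.
exists (fun j => if j is j'.+1 then fun f => if j' is 0%N then P' f else p j' f else P).
split=> //.
  by case=> [|[|j]] //=; rewrite ltnS => jd; apply: pprime.
case=> [_|[|j]] /=.
- by split=> //; exists f.
- rewrite ltnS => d0; have [sub [g [pg npg]]] := pS 0%N d0.
  split; first by move=> h /p0 /sub.
  by exists g; split=> // /p0.
- rewrite ltnS => jd; exact: pS.
Qed.

Lemma tower_eval_rmorph (A B : comAlgType k) (f : {rmorphism A -> B}) (u : nat -> A) d c :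
  (forall c : k, f c%:A = c%:A) ->
  f (tower_eval u d c) = tower_eval (f \o u) d c.
Proof.
move=> fk; elim: d c => [|d IH] c; first exact: fk.
rewrite !tower_evalS -horner_map /= -map_poly_comp; congr _.[_].
by apply: eq_map_poly => x /=; rewrite IH.
Qed.

End PolynomialTower.

(** * Polynomials with prescribed monomials *)

Section Supports.
Variables (k : closedFieldType) (N : nat).
Local Notation R := {mpoly k[N]}.
Implicit Types (C : 'X_{1..N} -> Prop) (p q : R).

Definition supported C p := forall m, m \in msupp p -> C m.

Lemma supported0 C : supported C 0.
Proof. by move=> m; rewrite msupp0. Qed.

Lemma supportedD C p q : supported C p -> supported C q -> supported C (p + q).
Proof. by move=> Cp Cq m /msuppD_le; rewrite mem_cat => /orP[/Cp|/Cq]. Qed.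

Lemma supportedZ C c p : supported C p -> supported C (c *: p).
Proof. by move=> Cp m /msuppZ_le /Cp. Qed.

Lemma supportedN C p : supported C p -> supported C (- p).
Proof. by move=> Cp; rewrite -scaleN1r; apply: supportedZ. Qed.

Lemma supported_sum C (I : Type) (r : seq I) (Q : pred I) (F : I -> R) :
  (forall i, Q i -> supported C (F i)) -> supported C (\sum_(i <- r | Q i) F i).
Proof.
move=> CF; elim/big_ind: _ => //; [exact: supported0|exact: supportedD].
Qed.

Lemma supportedX C m : C m -> supported C 'X_[m].
Proof. by move=> Cm m' /mem_msuppXP <-. Qed.

Lemma supportedM C1 C2 C p q : (forall m1 m2, C1 m1 -> C2 m2 -> C (m1 + m2)%MM) ->
  supported C1 p -> supported C2 q -> supported C (p * q).
Proof.
by move=> CM Cp Cq m /msuppM_le /allpairsP[[m1 m2] /= [/Cp h1 /Cq h2 ->]]; apply: CM.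
Qed.

Lemma supported_sub C1 C2 p : (forall m, C1 m -> C2 m) -> supported C1 p -> supported C2 p.
Proof. by move=> sub Cp m /Cp /sub. Qed.

Lemma supported_ind C (Pd : R -> Prop) :
  Pd 0 -> (forall p q, Pd p -> Pd q -> Pd (p + q)) ->
  (forall (c : k) p, Pd p -> Pd (c *: p)) -> (forall m, C m -> Pd 'X_[m]) ->
  forall p, supported C p -> Pd p.
Proof.
move=> P0 PD PZ PX p Cp; rewrite (mpolyE p) big_seq.
by elim/big_ind: _ => // m mp; apply/PZ/PX/Cp.
Qed.

Definition vars_in (U : {set 'I_N}) (m : 'X_{1..N}) := forall i, i \notin U -> m i = 0%N.

Lemma vars_inD U m1 m2 : vars_in U m1 -> vars_in U m2 -> vars_in U (m1 + m2)%MM.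
Proof. by move=> h1 h2 i iU; rewrite mnmDE h1 // h2. Qed.

Definition extract_var (i : 'I_N) : {rmorphism R -> {poly R}} :=
  mmap (polyC \o @mpolyC N k) (fun l => if l == i then 'X else ('X_l : R)%:P).

Lemma extract_var_const i p : supported (vars_in (~: [set i])) p -> extract_var i p = p%:P.
Proof.
move: p; apply: supported_ind.
- by rewrite rmorph0.
- by move=> p q hp hq; rewrite rmorphD hp hq polyCD.
- move=> c p hp; rewrite /extract_var /= mmapZ -/(extract_var i p) hp /=.
  by rewrite -polyCM mul_mpolyC.
move=> m mi; rewrite /extract_var /= mmapX /mmap1 mpolyXE_id rmorph_prod.
apply: eq_bigr => l _; case: eqP => [->|_]; last by rewrite rmorphXn.
by rewrite mi ?inE ?eqxx // !expr0.
Qed.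

Lemma tower_eval_supported (i : nat -> 'I_N) d (c : tower k d) :
  supported (vars_in [set i (val j) | j : 'I_d]) (tower_eval (fun j => 'X_(i j) : R) d c).
Proof.
elim: d c => [|d IH] c.
  rewrite /= -mulr_algl mulr1 alg_mpolyC => m; rewrite msuppC; case: ifP => // _.
  by rewrite inE => /eqP-> j _; rewrite mnm0E.
rewrite tower_evalS horner_coef; apply: supported_sum => j _; rewrite coef_map /=.
apply: (@supportedM (vars_in [set i (val j) | j : 'I_d.+1]) (vars_in [set i (val j) | j : 'I_d.+1])).
- exact: vars_inD.
- apply: supported_sub (IH _) => m hm l lU; apply: hm; apply: contra lU.
  case/imsetP => j0 _ ->; apply/imsetP; exists (widen_ord (leqnSn d) j0) => //.
- rewrite mpolyXn; apply: supportedX => l lU; rewrite mulmnE mnm1E.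
  case: eqP => [e|]; last by rewrite mul0n.
  by case/negP: lU; apply/imsetP; exists ord_max.
Qed.

(** The indices are distinct, so the coefficients of the outermost variable do not involve it;
    [extract_var] separates them and induction applies to each. *)
Lemma tower_eval_inj (i : nat -> 'I_N) d (c : tower k d) :
  (forall j1 j2, (j1 < d)%N -> (j2 < d)%N -> i j1 = i j2 -> j1 = j2) ->
  tower_eval (fun j => 'X_(i j) : R) d c = 0 -> c = 0.
Proof.
elim: d c => [|d IH] c iI.
  by move/eqP; rewrite /= scaler_eq0 oner_eq0 orbF => /eqP.
rewrite tower_evalS => /(congr1 (extract_var (i d))); rewrite rmorph0.
rewrite horner_coef rmorph_sum => e.
apply/polyP => j; rewrite coef0; apply: IH.
  by move=> j1 j2 h1 h2; apply: iI; apply: ltnW.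
case: (ltnP j (size (map_poly (tower_eval (fun j => 'X_(i j) : R) d) (c : {poly tower k d})))) => js;
  last first.
  by rewrite -(coef_map (tower_eval (fun j => 'X_(i j) : R) d)) nth_default.
rewrite -(coef_map (tower_eval (fun j => 'X_(i j) : R) d)).
transitivity ((\sum_(j < size (map_poly (tower_eval (fun j => 'X_(i j) : R) d) (c : {poly tower k d})))
   extract_var (i d) ((map_poly (tower_eval (fun j => 'X_(i j) : R) d) (c : {poly tower k d}))`_j
     * 'X_(i d) ^+ j))`_j); last by rewrite e coef0.
rewrite (eq_bigr (fun l : 'I__ => (map_poly (tower_eval (fun j => 'X_(i j) : R) d) (c : {poly tower k d}))`_l *: 'X^l)).
  rewrite coef_sum (bigD1 (Ordinal js)) //= coefZ coefXn eqxx mulr1 big1 ?addr0 //.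
  move=> l; rewrite -val_eqE /= => lj; rewrite coefZ coefXn eq_sym (negPf lj) mulr0 //.
move=> l _; rewrite rmorphM rmorphXn /= coef_map /=.
have -> : extract_var (i d) 'X_(i d) = 'X.
  by rewrite /extract_var /= mmapX mmap1U eqxx.
rewrite extract_var_const ?mul_polyC //.
apply: supported_sub (@tower_eval_supported i d _) => m hm l'.
rewrite !inE negbK => /eqP ->; apply: hm; apply/imsetP => -[j0 _ e0].
have := iI d j0 (leqnn _) (ltnW (ltn_ord j0)) e0; have := ltn_ord j0; lia.
Qed.

End Supports.

(** * Reduction to standard monomials and dimension counts *)

Lemma nontrivial_kernel (k : fieldType) (I : finType) L (M : I -> 'I_L -> k) :
  (L < #|I|)%N -> exists c : I -> k, (exists i, c i != 0) /\
    forall j, \sum_i c i * M i j = 0.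
Proof.
move=> LI; pose B := \matrix_(a < #|I|, j < L) M (enum_val a) j.
have : kermx B != 0.
  by rewrite -mxrank_eq0 mxrank_ker subn_eq0 -ltnNge (leq_ltn_trans (rank_leq_col _)).
case/rowV0Pn => v /sub_kermxP vB v0.
exists (fun i => v 0 (enum_rank i)); split.
  by case/rV0Pn: v0 => a va; exists (enum_val a); rewrite enum_valK.
move=> j; have /rowP/(_ j) := vB; rewrite !mxE => vBj.
rewrite (reindex (@enum_val I predT)) /=; last exact: onW_bij (enum_val_bij _).
by rewrite -[RHS]vBj; apply: eq_bigr => a _; rewrite !mxE enum_valK.
Qed.

Definition subspace (k : fieldType) (M : lmodType k) (W : M -> Prop) :=
  [/\ W 0, forall a b, W a -> W b -> W (a + b) & forall (c : k) a, W a -> W (c *: a)].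

Lemma subspace_sum (k : fieldType) (M : lmodType k) (W : M -> Prop) (I : Type)
    (r : seq I) (Q : pred I) (F : I -> M) :
  subspace W -> (forall i, Q i -> W (F i)) -> W (\sum_(i <- r | Q i) F i).
Proof. by case=> W0 WD _ WF; elim/big_ind: _. Qed.

Definition large_set N e (m : 'X_{1..N}) : {set 'I_N} := [set i | (e <= m i)%N].

(** There are at most [2 ^ N] choices for the set of large coordinates; these take at most [t.+1]
    values each, the others at most [e]. *)
Lemma card_few_large N n e t :
  (#|[set f : {ffun 'I_N -> 'I_t.+1} | (#|[set i | (e <= f i)%N]| <= n)%N]|
   <= 2 ^ N * e.+1 ^ N * t.+1 ^ n)%N.
Proof.
pose G (D : {set 'I_N}) : {set {ffun 'I_N -> 'I_t.+1}} :=
  [set f | f \in family (fun i (x : 'I_t.+1) => (i \in D) || (x < e)%N)].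
set B := [set f | _].
have sub : B \subset \bigcup_(D : {set 'I_N} | (#|D| <= n)%N) G D.
  apply/subsetP => f; rewrite inE => fn; apply/bigcupP.
  exists [set i | (e <= f i)%N] => //; rewrite inE; apply/familyP => i.
  by rewrite -[_ \in _]/((i \in [set i | e <= f i]) || (f i < e))%N inE ltnNge orbN.
apply: leq_trans (subset_leq_card sub) _.
apply: leq_trans (_ : \sum_(D : {set 'I_N} | (#|D| <= n)%N) #|G D| <= _)%N.
  elim/big_ind2: _ => [|x1 x2 x3 x4 h1 h2|//]; first by rewrite cards0.
  by apply: leq_trans (leq_card_setU _ _) _; apply: leq_add.
apply: leq_trans (_ : \sum_(D : {set 'I_N} | (#|D| <= n)%N) (e.+1 ^ N * t.+1 ^ n) <= _)%N.
  apply: leq_sum => D Dn; rewrite cardsE card_family foldrE big_map big_enum /=.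
  apply: leq_trans (_ : \prod_(i < N) (e.+1 * (if i \in D then t.+1 else 1)) <= _)%N.
    apply: leq_prod => i _; case: (i \in D) => /=.
      by apply: leq_trans (max_card _) _; rewrite card_ord leq_pmull.
    rewrite muln1; apply: leq_trans (_ : #|[set x : 'I_t.+1 | (x < e)%N]| <= _)%N.
      by rewrite cardsE.
    rewrite cardE -(size_map val) -[e.+1](size_iota 0).
    apply: uniq_leq_size; first by rewrite map_inj_uniq ?enum_uniq //; exact: val_inj.
    by move=> y /mapP[x]; rewrite mem_enum inE => xe ->; rewrite mem_iota /=; lia.
  rewrite big_split /= prod_nat_const card_ord leq_mul2l; apply/orP; right.
  by rewrite -big_mkcond /= prod_nat_const leq_pexp2l.
rewrite sum_nat_const -mulnA leq_mul2r; apply/orP; right.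
by apply: leq_trans (max_card _) _; rewrite -cardsT -powersetT card_powerset cardsT card_ord.
Qed.

Section Growth.
Variables (k : closedFieldType) (N : nat).
Local Notation R := {mpoly k[N]}.
Variables (W : R -> Prop) (subW : subspace W).
Variables (Cl : 'X_{1..N} -> Prop) (wt : 'X_{1..N} -> nat) (n e : nat).
Hypothesis wt_ge : forall (m : 'X_{1..N}) i, (m i <= wt m)%N.
Hypothesis reduce : forall m, Cl m -> (n < #|large_set e m|)%N ->
  exists q, W ('X_[m] - q) /\
    supported (fun m' => Cl m' /\
      ((wt m' < wt m)%N \/ ((wt m' <= wt m)%N /\ (m' < m)%O))) q.

Let std t (m : 'X_{1..N}) := ((#|large_set e m| <= n)%N /\ (wt m <= t)%N).
Let reducible t (p : R) := exists q, W (p - q) /\ supported (std t) q.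

Let reducible_supported C t p : (forall m, C m -> reducible t 'X_[m]) ->
  supported C p -> reducible t p.
Proof.
case: subW => W0 WD WZ CR; apply: supported_ind => //.
- by exists 0; rewrite subrr; split=> //; apply: supported0.
- move=> a b [qa [Wa sa]] [qb [Wb sb]]; exists (qa + qb); split.
    by have := WD _ _ Wa Wb; congr W; ring.
  exact: supportedD.
- move=> c a [q [Wq sq]]; exists (c *: q); split; last exact: supportedZ.
  by rewrite -scalerBr; apply: WZ.
Qed.

(** Outer induction on the weight, inner induction along the well-founded monomial order: a
    reduction either lowers the weight, or does not raise it and lowers the monomial. *)
Lemma monomial_reducible m : Cl m -> reducible (wt m) 'X_[m].
Proof.
case: subW => W0 WD WZ.
move: {2}(wt m).+1 (ltnSn (wt m)) => t; elim: t m => // t IHt.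
elim/(@ltmwf N) => m IHm wm Cm.
have mono t1 t2 p : (t1 <= t2)%N -> reducible t1 p -> reducible t2 p.
  move=> t12 [q [Wq sq]]; exists q; split=> //; apply: supported_sub sq => m' [h1 h2].
  by split=> //; apply: leq_trans t12.
case: (leqP #|large_set e m| n) => [ms|/(reduce Cm) [q [Wq sq]]].
  by exists 'X_[m]; rewrite subrr; split=> //; apply: supportedX.
have [|q' [Wq' sq']] := @reducible_supported _ (wt m) q _ sq.
  move=> m' [Cm' [lt|[le lo]]].
    by apply: (mono (wt m')); [exact: ltnW|apply: IHt => //; lia].
  by apply: (mono (wt m')) => //; apply: IHm => //; lia.
exists q'; split=> //.
by have := WD _ _ Wq Wq'; congr W; ring.
Qed.

(** Modulo [W] every [F i] is a combination of standard monomials of weight at most [t].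
    [card_few_large] bounds their number, and a larger family is dependent. *)
Lemma growth_bound : exists C : nat, forall t (I : finType) (F : I -> R),
  (forall i, exists q, W (F i - q) /\ supported (fun m => Cl m /\ (wt m <= t)%N) q) ->
  (C * t.+1 ^ n < #|I|)%N ->
  exists c : I -> k, (exists i, c i != 0) /\ W (\sum_i c i *: F i).
Proof.
case: subW => W0 WD WZ.
exists (2 ^ N * e.+1 ^ N)%N => t I F FR; set S := [set f : {ffun 'I_N -> 'I_t.+1} |
  (#|[set i | (e <= f i)%N]| <= n)%N].
move/(leq_ltn_trans (card_few_large N n e t)); rewrite -/S => SI.
have {FR} FR i : reducible t (F i).
  have [q [Wq sq]] := FR i.
  have [|q' [Wq' sq']] := @reducible_supported _ t q _ sq.
    move=> m [Cm mt]; have [q' [Wq' sq']] := monomial_reducible Cm.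
    exists q'; split=> //; apply: supported_sub sq' => m' [h1 h2]; split=> //.
    exact: leq_trans mt.
  by exists q'; split=> //; have := WD _ _ Wq Wq'; congr W; ring.
have [G GP] := boolp.choice FR.
pose mon (f : {ffun 'I_N -> 'I_t.+1}) : 'X_{1..N} := [multinom val (f i) | i < N].
have [c [c0 cE]] :=
  nontrivial_kernel (fun i (j : 'I_#|S|) => (G i)@_(mon (enum_val j))) SI.
exists c; split=> //.
have G0 : \sum_i c i *: G i = 0.
  apply/mpolyP => m; rewrite mcoeff0 raddf_sum /=.
  rewrite (eq_bigr (fun i => c i * (G i)@_m)); last by move=> i _; rewrite mcoeffZ.
  case: (boolp.EM (std t m)) => [[ml mt]|nstd]; last first.
    apply: big1 => i _; rewrite memN_msupp_eq0 ?mulr0 //; apply/negP => mi.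
    by apply: nstd; have [_] := GP i; apply.
  pose f := [ffun i => inord (m i) : 'I_t.+1].
  have fE i : val (f i) = m i.
    by rewrite ffunE /= inordK // ltnS; apply: leq_trans (wt_ge m i) mt.
  have fS : f \in S.
    rewrite inE; apply: leq_trans ml; apply: subset_leq_card; apply/subsetP => i.
    by rewrite !inE -fE.
  have mE : m = mon f by apply/mnmP => i; rewrite mnmE fE.
  by have := cE (enum_rank_in fS f); rewrite enum_rankK_in // -mE.
have -> : \sum_i c i *: F i = \sum_i c i *: (F i - G i).
  by under [RHS]eq_bigr do rewrite scalerBr; rewrite sumrB G0 subr0.
by apply: subspace_sum => // i _; apply: WZ; have [] := GP i.
Qed.

End Growth.

(** * Independence modulo a subspace and the Weyl relation *)

Section Independence.
Variables (k : fieldType) (M : lmodType k).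

Definition indep_mod (W : M -> Prop) (I : finType) (f : I -> M) :=
  forall c : I -> k, W (\sum_i c i *: f i) -> forall i, c i = 0.

Lemma indep_mod_sub (W W' : M -> Prop) (I : finType) (f : I -> M) :
  (forall p, W p -> W' p) -> indep_mod W' f -> indep_mod W f.
Proof. by move=> sub ind c /sub /ind. Qed.

(** Some size [m] admits an independent family while [m.+1] does not. Adjoining [a] to such a family
    then gives a relation with nonzero coefficient at [a]. *)
Lemma findim_of_dependent (W : M -> Prop) H : subspace W ->
  (forall f : 'I_H.+1 -> M, ~ indep_mod W f) ->
  exists m (e : 'I_m -> M), forall a, exists c : 'I_m -> k, W (a - \sum_(j < m) c j *: e j).
Proof.
move=> subW dep; have [W0 WD WZ] := subW.
pose Q m := exists e : 'I_m -> M, indep_mod W e.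
have [m [[e ind] nQ]] : exists m, Q m /\ ~ Q m.+1.
  apply: boolp.contrapT => nex.
  suff QH m : Q m by have [f /dep] := QH H.+1.
  elim: m => [|m Qm]; first by exists (fun=> 0) => c _ [].
  by apply: boolp.contrapT => nQ; apply: nex; exists m.
exists m, e => a.
pose f (i : 'I_m.+1) := if unlift ord_max i is Some j then e j else a.
have fl j : f (lift ord_max j) = e j by rewrite /f liftK.
have fm : f ord_max = a by rewrite /f unlift_none.
have : ~ indep_mod W f by move=> h; apply: nQ; exists f.
move=> /boolp.existsNP[c /boolp.not_implyP[Wc /boolp.existsNP[i ci]]].
move: Wc; rewrite (bigD1_ord ord_max) //= fm.
under eq_bigr do rewrite fl.
case: (eqVneq (c ord_max) 0) => [cm|cm] Wc.
  exfalso; apply: ci; case: (unliftP ord_max i) => [j ->|-> //].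
  by apply: (ind (fun j => c (lift ord_max j))); move: Wc; rewrite cm scale0r add0r.
exists (fun j => - ((c ord_max)^-1 * c (lift ord_max j))).
have := WZ (c ord_max)^-1 _ Wc; rewrite scalerDr scalerA mulVf // scale1r.
congr W; congr (_ + _); rewrite scaler_sumr -sumrN; apply: eq_bigr => j _.
by rewrite scaleNr opprK scalerA.
Qed.

Section Weyl.
Hypothesis hchar : [pchar k] =i pred0.
Variables (X Y : {linear M -> M}) (W : M -> Prop) (subW : subspace W).
Hypothesis comm : forall p, X (Y p) = Y (X p) + p.
Hypothesis WX : forall p, W p -> W (X p).

Definition plus_image p := exists w q, W w /\ p = w + Y q.

Lemma subspace_plus_image : subspace plus_image.
Proof.
have [W0 WD WZ] := subW; split.
- by exists 0, 0; rewrite linear0 addr0.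
- move=> _ _ [w [q [Ww ->]]] [w' [q' [Ww' ->]]]; exists (w + w'), (q + q').
  by split; [exact: WD|rewrite linearD addrACA].
- move=> c _ [w [q [Ww ->]]]; exists (c *: w), (c *: q).
  by split; [exact: WZ|rewrite linearZ scalerDr].
Qed.

Lemma iter_linear_sum a (I : Type) (r : seq I) (c : I -> k) (F : I -> M) :
  iter a Y (\sum_(i <- r) c i *: F i) = \sum_(i <- r) c i *: iter a Y (F i).
Proof.
by elim: a => //= a ->; rewrite linear_sum; apply: eq_bigr => i _; rewrite linearZ.
Qed.

Lemma comm_iter a p : X (iter a Y p) = iter a Y (X p) + a%:R *: iter a.-1 Y p.
Proof.
elim: a => [|a IH]; first by rewrite scale0r addr0.
rewrite /= comm IH linearD linearZ /= -addrA; congr (_ + _).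
case: a {IH} => [|a] /=; first by rewrite scale0r add0r scale1r.
by rewrite -[X in _ + X]scale1r -scalerDl natr1.
Qed.

(* Division by the integer [a + 1] below is where characteristic zero enters. *)
Lemma torsion_in_image a p : W (iter a Y p) -> plus_image p.
Proof.
have [W0 WD WZ] := subW; have [V0 VD VZ] := subspace_plus_image.
elim: a p => [|a IH] p Wp.
  by exists p, 0; rewrite linear0 addr0.
have /IH : W (iter a Y (Y (X p) + a.+1%:R *: p)).
  move: (WX Wp); rewrite comm_iter iterSr; congr W.
  have -> : iter a Y (Y (X p) + a.+1%:R *: p) =
            iter a Y (Y (X p)) + a.+1%:R *: iter a Y p.
    by move: (a.+1%:R) => l; elim: (a) => //= b ->; rewrite linearD linearZ.
  by [].
move=> V1; have V2 : plus_image (- Y (X p)).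
  by exists 0, (- X p); rewrite linearN add0r.
have := VD _ _ V1 V2; rewrite addrAC subrr add0r => /(VZ a.+1%:R^-1).
by rewrite scalerA mulVf ?scale1r // (pcharf0P k).1.
Qed.

(** [torsion_in_image] places the sum, hence its term with [j = 0], in [plus_image], so the
    coefficients of that term vanish. What remains is [Y] applied to a shorter sum. *)
Lemma indep_mod_iter t (I : finType) (f : I -> M) : indep_mod plus_image f ->
  indep_mod W (fun ij : I * 'I_t.+1 => iter ij.2 Y (f ij.1)).
Proof.
move=> ind c Wc.
have [V0 VD VZ] := subspace_plus_image.
(* The power [a] is carried along because each removal leaves one more [Y] outside. *)
suff gen b (d : I -> nat -> k) a :
    W (iter a Y (\sum_(j < b) iter j Y (\sum_i d i j *: f i))) ->
  forall i j, (j < b)%N -> d i j = 0.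
  case=> i j.
  have := @gen t.+1 (fun i j => c (i, inord j)) 0%N _ i j (ltn_ord j).
  rewrite inord_val; apply; move: Wc; congr W => /=.
  transitivity (\sum_i \sum_j c (i, j) *: iter j Y (f i)).
    by rewrite pair_bigA; apply: eq_bigr => -[].
  rewrite exchange_big /=; apply: eq_bigr => j0 _.
  by rewrite iter_linear_sum; apply: eq_bigr => i0 _; rewrite inord_val.
elim: b d a => [//|b IH] d a; rewrite big_ord_recl /= => Wd.
have tl : \sum_(i < b) iter (bump 0 i) Y (\sum_i0 d i0 (bump 0 i) *: f i0) =
          Y (\sum_(j < b) iter j Y (\sum_i d i j.+1 *: f i)).
  by rewrite linear_sum; apply: eq_bigr.
rewrite tl in Wd.
have d0 : forall i, d i 0%N = 0.
  apply: ind; have [w [q [Ww e]]] := torsion_in_image Wd.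
  exists w, (q - \sum_(j < b) iter j Y (\sum_i d i j.+1 *: f i)).
  by split=> //; rewrite linearB addrA -e addrK.
move=> i [|j] //; rewrite ltnS => jb.
apply: (IH (fun i j => d i j.+1) a.+1) => //.
move: Wd; rewrite big1 ?add0r ?iterSr // => i0 _; by rewrite d0 scale0r.
Qed.

End Weyl.
End Independence.

(** * The right module over the Weyl algebra and its symbols *)

Lemma mpoly_alg_ind (k : closedFieldType) N (Pd : {mpoly k[N]} -> Prop) :
  Pd 1 -> (forall p q, Pd p -> Pd q -> Pd (p + q)) ->
  (forall (c : k) p, Pd p -> Pd (c *: p)) ->
  (forall p q, Pd p -> Pd q -> Pd (p * q)) -> (forall i, Pd 'X_i) -> forall p, Pd p.
Proof.
move=> P1 PD PZ PM PX p.
apply: (@supported_ind k N (fun _ => True)) => //.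
  by have := PZ 0 _ P1; rewrite scale0r.
move=> m _; rewrite mpolyXE_id; elim/big_ind: _ => // i _.
by elim: (m i) => [|a IH]; rewrite ?expr0 // exprS; apply: PM.
Qed.

Lemma subspace_vO (k : closedFieldType) (A : comAlgType k) (v : (A -> A) -> Prop) :
  subspace (vO v).
Proof.
split.
- exists 0%N, (fun=> 0), (fun _ => id), (fun=> 0); split; first by case.
  by rewrite big_ord0.
- move=> _ _ [n1 [c1 [xi1 [f1 [v1 ->]]]]] [n2 [c2 [xi2 [f2 [v2 ->]]]]].
  pose cat T (g1 : 'I_n1 -> T) (g2 : 'I_n2 -> T) i :=
    match split i with inl i => g1 i | inr i => g2 i end.
  exists (n1 + n2)%N, (cat _ c1 c2), (cat _ xi1 xi2), (cat _ f1 f2); split.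
    by move=> j; rewrite /cat; case: split.
  rewrite big_split_ord /=; congr (_ + _); apply: eq_bigr => i _; rewrite /cat.
    by rewrite -[lshift _ i]/(unsplit (inl i)) unsplitK.
  by rewrite -[rshift _ i]/(unsplit (inr i)) unsplitK.
- move=> c _ [n1 [c1 [xi1 [f1 [v1 ->]]]]]; exists n1, (fun j => c * c1 j), xi1, f1.
  by split=> //; rewrite scaler_sumr; apply: eq_bigr => j _; rewrite scalerA.
Qed.

Section Symbols.
Variables (k : closedFieldType) (A : comAlgType k) (n : nat) (x : 'I_n -> A).
Variable v : (A -> A) -> Prop.
Hypothesis hv : lie_subalgebra v.
Local Notation R := {mpoly k[n + n]}.
Implicit Types (p q g : R) (m : 'X_{1..n + n}) (h : 'I_n -> R).

(* The variables [lshift n i] are the coordinates, the [rshift n i] their symbols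
   (the variables of the cotangent directions). *)
Local Notation cX i := ('X_(lshift n i) : R).
Local Notation sX i := ('X_(rshift n i) : R).

(** Symbols go to zero, as terms ending in a derivative do in the coinvariants. *)
Definition proj : {rmorphism R -> A} :=
  mmap (GRing.in_alg A) (fun l => if split l is inl i then x i else 0).

Lemma projZ c p : proj (c *: p) = c *: proj p.
Proof. by rewrite /proj /= mmapZ /= -scalerAl mul1r. Qed.

Lemma proj_cX i : proj (cX i) = x i.
Proof.
by rewrite /proj /= mmapX mmap1U -[lshift _ i]/(unsplit (inl i)) unsplitK.
Qed.

Lemma proj_sX i : proj (sX i) = 0.
Proof.
by rewrite /proj /= mmapX mmap1U -[rshift _ i]/(unsplit (inr i)) unsplitK.
Qed.

Definition xdeg m := (\sum_(i < n) m (lshift n i))%N.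
Definition sdeg m := (\sum_(i < n) m (rshift n i))%N.

Lemma xdegD m1 m2 : xdeg (m1 + m2)%MM = (xdeg m1 + xdeg m2)%N.
Proof. by rewrite /xdeg -big_split; apply: eq_bigr => i _; rewrite mnmDE. Qed.

Lemma sdegD m1 m2 : sdeg (m1 + m2)%MM = (sdeg m1 + sdeg m2)%N.
Proof. by rewrite /sdeg -big_split; apply: eq_bigr => i _; rewrite mnmDE. Qed.

Lemma mdeg_xs m : mdeg m = (xdeg m + sdeg m)%N.
Proof. by rewrite mdegE big_split_ord. Qed.

Lemma sdeg_cX i : sdeg U_(lshift n i)%MM = 0%N.
Proof. by rewrite /sdeg big1 // => j _; rewrite mnm1E eq_lrshift. Qed.

Lemma xdeg_sX i : xdeg U_(rshift n i)%MM = 0%N.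
Proof. by rewrite /xdeg big1 // => j _; rewrite mnm1E eq_rlshift. Qed.

Lemma sdeg_sX i : sdeg U_(rshift n i)%MM = 1%N.
Proof.
rewrite /sdeg (bigD1 i) //= mnm1E eqxx big1 // => j ji.
by rewrite mnm1E (inj_eq (@rshift_inj _ _)) eq_sym (negPf ji).
Qed.

Lemma xdeg_bound p : exists B, supported (fun m => (xdeg m <= B)%N) p.
Proof.
exists (msize p) => m /msize_mdeg_lt; rewrite mdeg_xs; lia.
Qed.

Definition xonly := supported (fun m => sdeg m = 0%N) : R -> Prop.

Lemma xonly_cX i : xonly (cX i).
Proof. by apply: supportedX; rewrite sdeg_cX. Qed.

Lemma xonlyC c : xonly c%:MP.
Proof.
move=> m; rewrite msuppC; case: ifP => // _; rewrite inE => /eqP ->.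
by rewrite /sdeg big1 // => i _; rewrite mnm0E.
Qed.

Lemma xonlyM p q : xonly p -> xonly q -> xonly (p * q).
Proof. by apply: supportedM => m1 m2; rewrite sdegD => -> ->. Qed.

Lemma xonly_deriv p i : xonly p -> mderiv (rshift n i) p = 0.
Proof.
move=> xp; apply/mpolyP => m; rewrite mcoeff_deriv mcoeff0.
rewrite memN_msupp_eq0 ?mul0rn //; apply/negP => /xp.
by rewrite sdegD sdeg_sX addn1.
Qed.

Definition vfield h p := \sum_i h i * mderiv (lshift n i) p.
Definition symbol h := \sum_i h i * sX i.
(** The derivation [vfield h] of the coordinate ring then lifts the field [eta]. *)
Definition lift_vfield h := exists2 eta, v eta &
  forall i, xonly (h i) /\ proj (h i) = eta (x i).

Lemma vfieldM h p q : vfield h (p * q) = p * vfield h q + q * vfield h p.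
Proof.
rewrite /vfield !mulr_sumr -big_split /=; apply: eq_bigr => i _.
by rewrite mderivM; ring.
Qed.

Lemma vfieldD h p q : vfield h (p + q) = vfield h p + vfield h q.
Proof.
rewrite /vfield -big_split /=; apply: eq_bigr => i _.
by rewrite mderivD mulrDr.
Qed.

Lemma vfieldZ h c p : vfield h (c *: p) = c *: vfield h p.
Proof.
rewrite /vfield scaler_sumr; apply: eq_bigr => i _.
by rewrite mderivZ scalerAr.
Qed.

Lemma mderivXU i j : mderiv i ('X_j : R) = (i == j)%:R.
Proof.
rewrite mderivX mnm1E eq_sym; case: eqP => [->|_]; last by rewrite scale0r.
by rewrite scale1r -{1}[U_(j)%MM]add0m addmK mpolyX0.
Qed.

Lemma vfield_cX h i : vfield h (cX i) = h i.
Proof.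
rewrite /vfield (bigD1 i) //= mderivXU eqxx mulr1 big1 ?addr0 // => j ji.
by rewrite mderivXU (inj_eq (@lshift_inj _ _)) (negPf ji) mulr0.
Qed.

Lemma vfield_sX h i : vfield h (sX i) = 0.
Proof.
by rewrite /vfield big1 // => j _; rewrite mderivXU eq_lrshift mulr0.
Qed.

(** Both sides are derivations along [proj], so it suffices to compare them on the variables; both
    vanish on symbols. *)
Lemma proj_vfield h eta p : v eta -> (forall i, proj (h i) = eta (x i)) ->
  proj (vfield h p) = eta (proj p).
Proof.
case: hv => vder _ _ _ _ /vder [etaD etaZ etaM] hE.
have eta1 : eta 1 = 0.
  by have /eqP := etaM 1 1; rewrite !mul1r -subr_eq0 opprD addrA subrr add0r oppr_eq0 => /eqP.
have eta0 : eta 0 = 0 by have := etaZ 0 0; rewrite !scale0r.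
move: p; apply: mpoly_alg_ind.
- by rewrite rmorph1 eta1 /vfield big1 ?rmorph0 // => i _; rewrite -mpolyC1 mderivC mulr0.
- by move=> p q hp hq; rewrite vfieldD !rmorphD /= hp hq etaD.
- by move=> c p hp; rewrite vfieldZ !projZ hp etaZ.
- by move=> p q hp hq; rewrite vfieldM rmorphD !rmorphM /= hp hq etaM.
- move=> i; case: (split_ordP i) => j ->; first by rewrite vfield_cX proj_cX hE.
  by rewrite vfield_sX proj_sX rmorph0 eta0.
Qed.

Lemma vfield_deriv h p i : (forall i, xonly (h i)) ->
  mderiv (rshift n i) (vfield h p) = vfield h (mderiv (rshift n i) p).
Proof.
move=> hx; rewrite /vfield raddf_sum; apply: eq_bigr => j _ /=.
by rewrite mderivM xonly_deriv // mul0r add0r mderiv_comm.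
Qed.

Lemma vfield_supported h p d a b :
  (forall i, xonly (h i)) -> (forall i, supported (fun m => (xdeg m <= d)%N) (h i)) ->
  supported (fun m => (xdeg m <= a)%N /\ sdeg m = b) p ->
  supported (fun m => (xdeg m <= a + d)%N /\ sdeg m = b) (vfield h p).
Proof.
move=> hx hd; move: p; apply: supported_ind.
- by rewrite /vfield big1 ?supported0 //; [exact: supported0|move=> i _; rewrite mderiv0 mulr0].
- by move=> p q hp hq; rewrite vfieldD; apply: supportedD.
- by move=> c p hp; rewrite vfieldZ; apply: supportedZ.
move=> m [ma mb]; apply: supported_sum => i _; rewrite mulrC.
apply: (@supportedM _ _ (fun m => (xdeg m <= a)%N /\ sdeg m = b)
                     (fun m => (xdeg m <= d)%N /\ sdeg m = 0%N)).
- by move=> m1 m2 [h1 h2] [h3 h4]; rewrite xdegD sdegD h2 h4 addn0; split=> //; lia.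
- rewrite mderivX; apply: supportedZ; apply: supportedX; split.
    apply: leq_trans ma; apply: leq_sum => j _; rewrite mnmBE; exact: leq_subr.
  rewrite -mb; apply: eq_bigr => j _; by rewrite mnmBE mnm1E eq_lrshift subn0.
- by move=> m' m'h; split; [exact: hd m'h|exact: hx m'h].
Qed.

(* The span of the [p * symbol h + vfield h p] is the right submodule generated by
   the vector fields, written in the Weyl algebra with derivatives to the right. *)
Inductive dmod_rel : R -> Prop :=
| dmod_rel0 : dmod_rel 0
| dmod_rel_ker p g : xonly g -> proj g = 0 -> dmod_rel (p * g)
| dmod_rel_vfield p h : lift_vfield h -> dmod_rel (p * symbol h + vfield h p)
| dmod_relD p q : dmod_rel p -> dmod_rel q -> dmod_rel (p + q).

Lemma subspace_dmod_rel : subspace dmod_rel.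
Proof.
split; [exact: dmod_rel0|exact: dmod_relD|move=> c p].
elim=> [|q g gx g0|q h hl|q q' _ hq _ hq'].
- by rewrite scaler0; apply: dmod_rel0.
- by rewrite scalerAl; apply: dmod_rel_ker.
- by rewrite scalerDr scalerAl -vfieldZ; apply: dmod_rel_vfield.
- by rewrite scalerDr; apply: dmod_relD.
Qed.

(** On operators written with derivatives to the right, [opY] and [opX] are right multiplication by
    d_i and by x_i; the derivative in [opX] comes from moving x_i past the powers of d_i. *)
Definition opY i p := sX i * p.
Definition opX i p := cX i * p + mderiv (rshift n i) p.

Fact opY_linear i : linear (opY i).
Proof. by move=> c p q; rewrite /opY mulrDr scalerAr. Qed.
Fact opX_linear i : linear (opX i).
Proof.
by move=> c p q; rewrite /opX mulrDr mderivD mderivZ scalerDr scalerAr addrACA.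
Qed.
HB.instance Definition _ i := GRing.isLinear.Build k R R *:%R (opY i) (opY_linear i).
HB.instance Definition _ i := GRing.isLinear.Build k R R *:%R (opX i) (opX_linear i).

Lemma opXY i p : opX i (opY i p) = opY i (opX i p) + p.
Proof. by rewrite /opX /opY mderivM mderivXU eqxx mulr1n; ring. Qed.

Lemma opXY_comm i j p : i != j -> opX i (opY j p) = opY j (opX i p).
Proof.
move=> ij; rewrite /opX /opY mderivM mderivXU (inj_eq (@rshift_inj _ _)) (negPf ij) mulr0n.
by ring.
Qed.

(** For a vector field the result is the sum of the relations for [cX i * q] and for the derivative
    of [q]: the term [h i * q] arises from the symbol on one side and from [vfield h (cX i)] on the
    other. *)
Lemma dmod_rel_opX i p : dmod_rel p -> dmod_rel (opX i p).
Proof.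
elim=> [|q g gx g0|q h hl|q q' _ hq _ hq'].
- by rewrite linear0; apply: dmod_rel0.
- rewrite /opX mderivM (xonly_deriv _ gx) mulr0 addr0 mulrA.
  by apply: dmod_relD; apply: dmod_rel_ker.
- have hx j : xonly (h j) by case: hl => eta _ /(_ j) [].
  have ds : mderiv (rshift n i) (symbol h) = h i.
    rewrite /symbol raddf_sum (bigD1 i) //= mderivM xonly_deriv // mul0r add0r.
    rewrite mderivXU eqxx mulr1 big1 ?addr0 // => j ji.
    rewrite mderivM xonly_deriv // mul0r add0r mderivXU (inj_eq (@rshift_inj _ _)).
    by rewrite eq_sym (negPf ji) mulr0.
  have := dmod_relD (dmod_rel_vfield (cX i * q) hl)
                    (dmod_rel_vfield (mderiv (rshift n i) q) hl).
  rewrite vfieldM vfield_cX /opX mderivD mderivM ds vfield_deriv //.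
  by congr dmod_rel; ring.
- by rewrite linearD; apply: dmod_relD.
Qed.

(** Relations of M modulo the images of d_i for [i < r]. They interpolate between M and the
    coinvariants, so derivatives can be treated one by one. *)
Definition dmod_rel_upto r p := exists w (q : 'I_n -> R), dmod_rel w /\
  p = w + \sum_(i < n | (i < r)%N) sX i * q i.

Lemma subspace_dmod_rel_upto r : subspace (dmod_rel_upto r).
Proof.
have [W0 WD WZ] := subspace_dmod_rel; split.
- exists 0, (fun=> 0); split=> //; rewrite big1 ?addr0 // => i _; exact: mulr0.
- move=> _ _ [w [q [Ww ->]]] [w' [q' [Ww' ->]]]; exists (w + w'), (fun i => q i + q' i).
  split; first exact: WD.
  under [in RHS]eq_bigr do rewrite mulrDr.
  by rewrite big_split /= addrACA.
- move=> c _ [w [q [Ww ->]]]; exists (c *: w), (fun i => c *: q i).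
  split; first exact: WZ.
  by rewrite scalerDr scaler_sumr; congr (_ + _); apply: eq_bigr => i _; rewrite scalerAr.
Qed.

(** x_i commutes with the derivatives already divided out, whose indices are below [r] and so differ
    from [i]. *)
Lemma dmod_rel_upto_opX (r i : 'I_n) p : (r <= i)%N ->
  dmod_rel_upto r p -> dmod_rel_upto r (opX i p).
Proof.
move=> ri [w [q [Ww ->]]]; exists (opX i w), (fun j => opX i (q j)).
split; first exact: dmod_rel_opX.
rewrite linearD linear_sum /=; congr (_ + _); apply: eq_bigr => j jr.
by rewrite -[sX j * q j]/(opY j (q j)) opXY_comm // -val_eqE /=; lia.
Qed.

Lemma dmod_rel_upto_image (r : 'I_n) p :
  plus_image (opY r) (dmod_rel_upto r) p -> dmod_rel_upto r.+1 p.
Proof.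
move=> [w' [q' [[w [q [Ww ->]]] ->]]].
exists w, (fun i => if i == r then q' else q i); split=> //.
rewrite -addrA; congr (_ + _); rewrite [RHS](bigD1 r) //= eqxx addrC; congr (_ + _).
apply: eq_big => [i|i ir]; first by rewrite -val_eqE /=; lia.
by case: eqP ir => // ->; rewrite ltnn.
Qed.

Lemma proj_dmod_rel p : dmod_rel_upto n p -> vO v (proj p).
Proof.
have [V0 VD VZ] := subspace_vO v.
move=> [w [q [Ww ->]]]; rewrite rmorphD rmorph_sum /=.
rewrite [X in _ + X]big1 ?addr0; last by move=> i _; rewrite rmorphM /= proj_sX mul0r.
elim: Ww => [|p' g gx g0|p' h [eta veta hl]|p' q' _ hp _ hq].
- by rewrite rmorph0.
- by rewrite rmorphM /= g0 mulr0.
- rewrite rmorphD rmorphM /symbol rmorph_sum /=.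
  rewrite big1 ?mulr0 ?add0r; last by move=> i _; rewrite rmorphM /= proj_sX mulr0.
  rewrite (proj_vfield _ veta); last by move=> i; case: (hl i).
  exists 1%N, (fun=> 1), (fun=> eta), (fun=> proj p'); split=> //.
  by rewrite big_ord1 scale1r.
- by rewrite rmorphD; apply: VD.
Qed.

Hypothesis hchar : [pchar k] =i pred0.

(** By [proj_dmod_rel] the family is independent modulo all derivatives. These are removed from the
    relations from the highest index down, each use of [indep_mod_iter] multiplying the family by
    [t.+1]. *)
Lemma indep_dmod_rel (I : finType) (f : I -> R) t D :
  (forall i, supported (fun m => (xdeg m <= D)%N /\ sdeg m = 0%N) (f i)) ->
  indep_mod (vO v) (fun i => proj (f i)) ->
  exists (I' : finType) (F : I' -> R), [/\ #|I'| = (#|I| * t.+1 ^ n)%N,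
    indep_mod dmod_rel F &
    forall i, supported (fun m => (xdeg m <= D)%N /\ (sdeg m <= n * t)%N) (F i)].
Proof.
move=> fs find.
suff gen r : (r <= n)%N -> exists (I' : finType) (F : I' -> R),
    [/\ #|I'| = (#|I| * t.+1 ^ r)%N, indep_mod (dmod_rel_upto (n - r)) F &
    forall i, supported (fun m => (xdeg m <= D)%N /\ (sdeg m <= r * t)%N) (F i)].
  have [I' [F [cI indF sF]]] := gen n (leqnn n).
  exists I', F; split=> //; apply: indep_mod_sub indF => p Wp.
  exists p, (fun=> 0); split=> //; rewrite big1 ?addr0 // => i _; exact: mulr0.
elim: r => [|r IH] rn.
  exists I, f; split; first by rewrite muln1.
    rewrite subn0 => c Wc; apply: find; have := proj_dmod_rel Wc.
    by rewrite rmorph_sum; under eq_bigr do rewrite projZ.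
  by move=> i; apply: supported_sub (fs i) => m [h1 h2]; rewrite h2.
have [I' [F [cI indF sF]]] := IH (ltnW rn).
have jP : (n - r.+1 < n)%N by lia.
pose j := Ordinal jP.
have jS : (n - r = j.+1)%N by rewrite /=; lia.
exists (I' * 'I_t.+1)%type, (fun ij : I' * 'I_t.+1 => iter ij.2 (opY j) (F ij.1)).
split.
- by rewrite card_prod card_ord cI expnS mulnA mulnAC.
- apply: (@indep_mod_iter k R hchar (opX j) (opY j) _ (subspace_dmod_rel_upto j)).
  + exact: opXY.
  + by move=> p; apply: dmod_rel_upto_opX.
  by apply: indep_mod_sub indF => p; rewrite jS; apply: dmod_rel_upto_image.
- case=> i [a at1] /=.
  have : supported (fun m => (xdeg m <= D)%N /\ (sdeg m <= r * t + a)%N)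
           (iter a (opY j) (F i)).
    elim: (a) => [|b IHb] /=; first by rewrite addn0.
    apply: (@supportedM _ _ (fun m => m = U_(rshift n j)%MM)) IHb.
      by move=> m1 m2 -> [h1 h2]; rewrite xdegD sdegD xdeg_sX sdeg_sX; split; lia.
    exact: supportedX.
  by apply: supported_sub => m [h1 h2]; split=> //; rewrite mulSn; lia.
Qed.

(** Equations, in the cotangent space, of the common zero locus of the symbols of [v]. *)
Inductive symbol_ideal : R -> Prop :=
| symbol_ideal0 : symbol_ideal 0
| symbol_ideal_ker p g : xonly g -> proj g = 0 -> symbol_ideal (p * g)
| symbol_ideal_vfield p h : lift_vfield h -> symbol_ideal (p * symbol h)
| symbol_idealD p q : symbol_ideal p -> symbol_ideal q -> symbol_ideal (p + q).

Lemma symbol_ideal_is_ideal : is_ideal symbol_ideal.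
Proof.
split; [exact: symbol_ideal0|exact: symbol_idealD|move=> a p].
elim=> [|q g gx g0|q h hl|q q' _ hq _ hq'].
- by rewrite mulr0; apply: symbol_ideal0.
- by rewrite mulrA; apply: symbol_ideal_ker.
- by rewrite mulrA; apply: symbol_ideal_vfield.
- by rewrite mulrDr; apply: symbol_idealD.
Qed.

(** The extra variable records the symbol degree, so coefficients are the components homogeneous in
    the symbols. *)
Definition grade : {rmorphism R -> {poly R}} :=
  mmap (polyC \o @mpolyC (n + n) k)
    (fun l => if split l is inl i then (cX i)%:P else ('X_l : R)%:P * 'X).

Lemma gradeZ c p : grade (c *: p) = c%:MP *: grade p.
Proof. by rewrite /grade /= mmapZ /= mul_polyC. Qed.

Lemma gradeX m : grade 'X_[m] = ('X_[m] : R)%:P * 'X^(sdeg m).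
Proof.
rewrite /grade /= mmapX /mmap1 mpolyXE_id rmorph_prod /= !big_split_ord /=.
rewrite -mulrA; congr (_ * _).
  apply: eq_bigr => i _; by rewrite -[lshift _ i]/(unsplit (inl i)) unsplitK rmorphXn.
rewrite /sdeg -prodrXr -big_split /=; apply: eq_bigr => i _.
by rewrite -[rshift _ i]/(unsplit (inr i)) unsplitK exprMn rmorphXn.
Qed.

Lemma coef_gradeD p q j : (grade (p + q))`_j = (grade p)`_j + (grade q)`_j.
Proof. by rewrite rmorphD coefD. Qed.

Lemma mcoeff_grade p j m : ((grade p)`_j)@_m = if sdeg m == j then p@_m else 0.
Proof.
apply: (@supported_ind k _ (fun _ => True) (fun p => ((grade p)`_j)@_m =
  if sdeg m == j then p@_m else 0) _ _ _ _ p) => // {p}.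
- by rewrite rmorph0 coef0 mcoeff0; case: ifP.
- move=> p q hp hq.
  rewrite coef_gradeD.
  apply: (etrans (mcoeffD m _ _)); apply: (etrans (f_equal2 +%R hp hq)).
  by case: (sdeg m == j); [rewrite mcoeffD|rewrite addr0].
- move=> c p hp; rewrite gradeZ coefZ mul_mpolyC !mcoeffZ hp; case: ifP => //.
  by rewrite mulr0.
move=> m' _; rewrite gradeX coefCM coefXn; case: (eqVneq j (sdeg m')) => [->|jm].
  rewrite mulr1 mcoeffX; case: eqP => [->|]; first by rewrite eqxx.
  by case: ifP.
rewrite mulr0 mcoeff0 mcoeffX; case: eqP => // e; case: eqP => // mm.
by rewrite -e mm eqxx in jm.
Qed.

Lemma grade_supported C p j : supported C p ->
  supported (fun m => C m /\ sdeg m = j) (grade p)`_j.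
Proof.
move=> Cp m; rewrite mcoeff_msupp mcoeff_grade; case: (sdeg m =P j) => [mj|_]; last by rewrite eqxx.
by rewrite -mcoeff_msupp => /Cp.
Qed.

Lemma grade_xonly g : xonly g -> grade g = g%:P.
Proof.
move=> gx; apply/polyP => j; rewrite coefC; apply/mpolyP => m; rewrite mcoeff_grade.
case: (boolP (m \in msupp g)) => [mg|/memN_msupp_eq0 mg].
  by rewrite (gx _ mg) eq_sym; case: ifP => //; rewrite mcoeff0.
by rewrite mg; case: ifP; case: ifP; rewrite ?mg ?mcoeff0.
Qed.

Lemma grade_symbol h : (forall i, xonly (h i)) -> grade (symbol h) = (symbol h)%:P * 'X.
Proof.
move=> hx; rewrite /symbol !rmorph_sum mulr_suml; apply: eq_bigr => i _ /=.
rewrite !rmorphM /= grade_xonly // gradeX sdeg_sX expr1 mulrA //.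
Qed.

(* A homogeneous component of an element of the symbol ideal equals, modulo the
   relations, an expression whose symbol degree is lower by one. *)
Lemma symbol_ideal_reduce p j : symbol_ideal p -> exists N0, forall m',
  exists q, dmod_rel ('X_[m'] * (grade p)`_j - q) /\
    supported (fun m => (xdeg m <= xdeg m' + N0)%N /\ (sdeg m).+1 = (sdeg m' + j)%N) q.
Proof.
elim=> [|q g gx g0|q h hl|q q' _ [N1 h1] _ [N2 h2]].
- exists 0%N => m'; exists 0; rewrite rmorph0 coef0 mulr0 subr0.
  by split; [exact: dmod_rel0|exact: supported0].
- exists 0%N => m'; exists 0; rewrite rmorphM (grade_xonly gx) coefMC mulrA subr0.
  by split; [exact: dmod_rel_ker|exact: supported0].
- have hx i : xonly (h i) by case: hl => eta _ /(_ i) [].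
  have [d hd] : exists d, forall i, supported (fun m => (xdeg m <= d)%N) (h i).
    have [b bP] := boolp.choice (fun i => xdeg_bound (h i)).
    exists (\max_i b i) => i; apply: supported_sub (bP i) => m /leq_trans; apply.
    exact: leq_bigmax.
  have [B qB] := xdeg_bound q.
  exists (B + d)%N => m'; rewrite rmorphM /= grade_symbol // mulrA coefMX coefMC.
  case: j => [|j] /=.
    exists 0; rewrite mulr0 subr0.
    by split; [exact: dmod_rel0|exact: supported0].
  (* The relation [p * symbol h + vfield h p] trades the factor [symbol h] for a term with one
     symbol less. *)
  exists (- vfield h ('X_[m'] * (grade q)`_j)); split.
    by rewrite opprK mulrA; apply: dmod_rel_vfield.
  apply: supportedN; rewrite addnA addnS.
  apply: (@supported_sub _ _ (fun m => (xdeg m <= xdeg m' + B + d)%N /\ sdeg m = (sdeg m' + j)%N)).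
    by move=> m [h1 ->].
  apply: vfield_supported => //.
  apply: (@supportedM _ _ (fun m => m = m') (fun m => (xdeg m <= B)%N /\ sdeg m = j)).
  + by move=> m1 m2 -> [h1 h2]; rewrite xdegD sdegD h2 leq_add2l.
  + exact: supportedX.
  + exact: grade_supported.
- exists (maxn N1 N2) => m'.
  have [q1 [W1 s1]] := h1 m'; have [q2 [W2 s2]] := h2 m'.
  exists (q1 + q2); split.
    rewrite coef_gradeD mulrDr opprD addrACA; exact: dmod_relD.
  apply: supportedD; [apply: supported_sub s1|apply: supported_sub s2] => m [l1 l2]; split=> //.
    by apply: leq_trans l1 _; rewrite leq_add2l leq_maxl.
  by apply: leq_trans l1 _; rewrite leq_add2l leq_maxr.
Qed.

End Symbols.

(** * Comparison of the lower and upper bounds *)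

Lemma exists_subset_card (T : finType) (L : {set T}) n :
  (n <= #|L|)%N -> exists2 U : {set T}, U \subset L & #|U| = n.
Proof.
move=> nL; exists [set y in take n (enum L)].
  by apply/subsetP => y; rewrite inE => /mem_take; rewrite mem_enum.
rewrite cardsE (card_uniqP _) ?take_uniq ?enum_uniq // size_take -cardE.
by case: ltngtP nL => // ->.
Qed.

Lemma mlead_le_large N (k : closedFieldType) (f : {mpoly k[N]}) e (m : 'X_{1..N})
    (U : {set 'I_N}) :
  f != 0 -> supported (vars_in U) f -> (mdeg (mlead f) < e)%N ->
  U \subset large_set e m -> (mlead f <= m)%MM.
Proof.
move=> f0 fU fe UL; apply/mnm_lepP => i; case: (boolP (i \in U)) => iU.
  have := subsetP UL i iU; rewrite inE; apply: leq_trans; apply: ltnW.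
  by apply: leq_ltn_trans fe; rewrite mdegE (bigD1 i) //= leq_addr.
by rewrite (fU _ (mlead_supp f0) i iU).
Qed.

(** Each eliminant becomes a rewriting rule for the multiples of its leading monomial.
    [growth_bound] and [indep_dmod_rel] then give opposite bounds. *)
Lemma coinvariants_findim_of_eliminants (k : closedFieldType) (A : comAlgType k)
    n (x : 'I_n -> A) (v : (A -> A) -> Prop) :
  [pchar k] =i pred0 -> lie_subalgebra v ->
  (forall a, exists p, xonly p /\ proj x p = a) ->
  (forall U : {set 'I_(n + n)}, #|U| = n.+1 ->
    exists p, [/\ p != 0, symbol_ideal x v p & supported (vars_in U) p]) ->
  coinvariants_findim v.
Proof.
move=> hchar hv lifts elims.
have pick (U : {set 'I_(n + n)}) : exists fN : {mpoly k[n + n]} * nat * nat,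
    #|U| = n.+1 -> [/\ fN.1.1 != 0,
      supported (fun m => vars_in U m /\ sdeg m = fN.2) fN.1.1 & forall m',
      exists q, dmod_rel x v ('X_[m'] * fN.1.1 - q) /\
        supported (fun m => (xdeg m <= xdeg m' + fN.1.2)%N /\
                            (sdeg m).+1 = (sdeg m' + fN.2)%N) q].
  case: (eqVneq #|U| n.+1) => [cU|/eqP cU]; last by exists (0, 0%N, 0%N).
  have [p [p0 Jp pU]] := elims U cU.
  (* The component containing the leading monomial of [p] is nonzero and homogeneous in the
     symbols. *)
  pose j := sdeg (mlead p); have [N0 hN0] := symbol_ideal_reduce j Jp.
  exists ((grade k n p)`_j, N0, j) => _; split=> //=; last exact: grade_supported.
  apply: contra_neq p0 => f0; apply/eqP; rewrite -mleadc_eq0.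
  by have := mcoeff_grade p j (mlead p); rewrite f0 mcoeff0 eqxx => <-.
have [fN fNP] := boolp.choice pick.
(* A derivative weighs more than any gain in coordinate degree, so losing one symbol lowers the
   weight. *)
pose N := (\max_U (fN U).1.2).+1.
pose e := (\max_U mdeg (mlead (fN U).1.1)).+1.
pose wt (m : 'X_{1..n + n}) := (xdeg m + N * sdeg m)%N.
have wt_ge (m : 'X_{1..n + n}) i : (m i <= wt m)%N.
  rewrite /wt; case: (split_ordP i) => j ->.
    by apply: leq_trans (leq_addr _ _); rewrite /xdeg (bigD1 j) //= leq_addr.
  apply: leq_trans (leq_addl _ _); rewrite /sdeg (bigD1 j) //= mulnDr.
  by apply: leq_trans (leq_addr _ _); rewrite leq_pmull.
have [|C CP] := @growth_bound k (n + n) (dmod_rel x v) (subspace_dmod_rel x v)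
  (fun _ => True) wt n e wt_ge.
  move=> m _ /exists_subset_card [U UL cU].
  have [f0 fs fr] := fNP U cU; move: f0 fs fr.
  set f := (fN U).1.1; set N0 := (fN U).1.2; set j := (fN U).2 => f0 fs fr.
  have NN0 : (N0 < N)%N by rewrite /N ltnS; apply: (bigmax_sup U).
  have lm : (mlead f <= m)%MM.
    apply: (mlead_le_large f0 _ _ UL); first by apply: supported_sub fs => m' [].
    by rewrite /e ltnS; apply: (bigmax_sup U).
  set l := mlead f in lm.
  have lj : sdeg l = j by have [] := fs _ (mlead_supp f0).
  pose m' := (m - l)%MM; have mE : m = (m' + l)%MM by rewrite submK.
  have [q [Wq sq]] := fr m'.
  have [W0 WD WZ] := subspace_dmod_rel x v.
  pose c := f@_l; have c0 : c != 0 by rewrite mleadc_eq0.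
  (* The multiple of [f] is replaced by [q], of lower weight; the other terms of [f] lie below [l]
     in the monomial order. *)
  exists (c^-1 *: q - 'X_[m'] * (c^-1 *: f - 'X_[l])); split.
    have := WZ c^-1 _ Wq; congr (dmod_rel x v).
    by rewrite mE mpolyXD scalerBr scalerAr; ring.
  apply: supportedD.
    apply: supportedZ; apply: supported_sub sq => a [h1 h2]; split=> //; left.
    rewrite /wt mE xdegD sdegD lj; nia.
  apply: supportedN.
  apply: (@supportedM _ _ (fun a => a = m') (fun a => a \in msupp f /\ a != l)).
  - move=> m1 a -> [af al]; split=> //; right; have [_ aj] := fs _ af.
    have ale := msupp_le_mlead af.
    (* All monomials of [f] have symbol degree [j], so comparing total degrees compares coordinate
       degrees. *)
    have := lemc_mdeg ale; rewrite !mdeg_xs -/l lj aj leq_add2r => xal; split.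
      by rewrite /wt mE !xdegD !sdegD lj aj; nia.
    by rewrite mE ltmc_add2r Order.POrderTheory.lt_neqAle al.
  - exact: supportedX.
  - move=> a; rewrite mcoeff_msupp mcoeffB mcoeffZ mcoeffX eq_sym => ha.
    case: (eqVneq a l) ha => [->|al] ha.
      by rewrite mulVf // subrr eqxx in ha.
    split=> //; rewrite mcoeff_msupp; apply: contraNneq ha => ->.
    by rewrite mulr0 subr0.
(* [H] must not depend on the degree [D] of the lifts below. With [t = D] the weights are at most
   [D + N * (n * D)], whose successor is at most [(N * n).+1 * D.+1]. *)
pose H := (C * (N * n).+1 ^ n)%N.
apply: (findim_of_dependent (H := H) (subspace_vO v)) => g ind.
have [p pP] := boolp.choice (fun i => lifts (g i)).
have [b bP] := boolp.choice (fun i => xdeg_bound (p i)).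
pose D := (\max_i b i)%N.
have [||I' [F [cI indF sF]]] := @indep_dmod_rel k A n x v hv hchar 'I_H.+1 p D D.
- move=> i m mp; split; last by have [px _] := pP i; exact: px mp.
  by apply: leq_trans (bP i m mp) _; apply: (bigmax_sup i).
- move=> c; under eq_bigr do rewrite (pP _).2; exact: ind.
have [||c [[i ci] Wc]] := CP (D + N * (n * D))%N I' F.
- move=> i; exists (F i); rewrite subrr; split; first exact: dmod_rel0.
  by apply: supported_sub (sF i) => m [h1 h2]; split=> //; rewrite /wt; nia.
- rewrite cI card_ord; apply: leq_ltn_trans (_ : H * D.+1 ^ n < _)%N; last first.
    by rewrite ltn_pmul2r // expn_gt0.
  rewrite /H -mulnA leq_mul2l -expnMn; apply/orP; right.
  by case: (n) => // a; rewrite leq_exp2r //; nia.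
by case/eqP: ci; apply: indF Wc i.
Qed.

(** * Minors and derivations at points *)

(* Expansion of a bordered determinant along its last row; the cofactors [a] do
   not depend on that row. *)
Lemma bordered_det (A : comNzRingType) n r (f : 'I_n -> 'I_r -> A) (g : 'I_n -> A)
    (idx : 'I_r -> 'I_n) : exists a : 'I_r -> A, forall i,
  \det (\matrix_(m < r.+1, l < r.+1)
     let row := if unlift ord_max m is Some m0 then idx m0 else i in
     if unlift ord_max l is Some l0 then f row l0 else g row) =
  g i * \det (\matrix_(m < r, l < r) f (idx m) l) + \sum_l f i l * a l.
Proof.
pose G := \matrix_(m < r, l < r.+1)
  if unlift ord_max l is Some l0 then f (idx m) l0 else g (idx m).
pose cof (l : 'I_r.+1) := (-1) ^+ (r + l) * \det (col' l G).
exists (fun l => cof (lift ord_max l)) => i; set B := \matrix_(m, l) _.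
have BG l : row' ord_max (col' l B) = col' l G.
  by apply/matrixP => m l'; rewrite !mxE liftK.
rewrite (expand_det_row B ord_max) (bigD1_ord ord_max) //=; congr (_ + _).
  rewrite mxE !unlift_none /=; congr (_ * _).
  rewrite /cofactor BG /= addnn -mul2n exprM sqrrN expr1n expr1n mul1r.
  by congr (\det _); apply/matrixP => m l; rewrite !mxE liftK.
apply: eq_bigr => l _; rewrite mxE unlift_none liftK; congr (_ * _).
by rewrite /cofactor BG.
Qed.

Lemma point_derivation_span (k : closedFieldType) (A : comAlgType k) (s : seq A)
    n (x : 'I_n -> A) r (pt : A -> k) (eta : A -> A) (xis : 'I_r -> A -> A)
    (c : 'I_r -> k) : is_point pt -> is_derivation eta ->
  (forall l, is_derivation (xis l)) -> (forall a, a \in s -> exists i, a = x i) ->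
  (forall i, pt (eta (x i)) = \sum_l c l * pt (xis l (x i))) ->
  forall a, gen_by s a -> pt (eta a) = \sum_l c l * pt (xis l a).
Proof.
move=> [ptD ptM ptZ pt1] [etaD etaZ etaM] dxis sx hx.
have pt0 : pt 0 = 0 by have := ptZ 0 0; rewrite scale0r mul0r.
have der1 xi : is_derivation xi -> xi 1 = 0.
  case=> _ _ xiM; apply/eqP; have /eqP := xiM 1 1.
  by rewrite !mul1r -subr_eq0 opprD addrA subrr add0r oppr_eq0.
move=> a; elim=> [b|b /sx[i ->]|b d _ hb _ hd|b d _ hb _ hd].
- rewrite etaZ der1 // scaler0 pt0 big1 // => l _.
  by have [_ xiZ _] := dxis l; rewrite xiZ der1 // scaler0 pt0 mulr0.
- exact: hx.
- rewrite etaD ptD hb hd -big_split; apply: eq_bigr => l _ /=.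
  by have [xiD _ _] := dxis l; rewrite xiD ptD mulrDr.
- rewrite etaM ptD !ptM hb hd !mulr_sumr -big_split; apply: eq_bigr => l _ /=.
  by have [_ _ xiM] := dxis l; rewrite xiM ptD !ptM; ring.
Qed.

Lemma xonly_det (k : closedFieldType) n r (M : 'M[{mpoly k[n + n]}]_r) :
  (forall i j, xonly (M i j)) -> xonly (\det M).
Proof.
move=> xM; apply: supported_sum => s _; apply: xonlyM.
  case: (perm.odd_perm s); rewrite ?expr1 ?expr0; last by rewrite -mpolyC1; apply: xonlyC.
  by apply: supportedN; rewrite -mpolyC1; apply: xonlyC.
elim/big_ind: _ => //; [by rewrite -mpolyC1; apply: xonlyC|exact: xonlyM].
Qed.

(** * Dependence relations on the zero locus of the symbols *)

Section Eliminants.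
Variables (k : closedFieldType) (A : comAlgType k) (s : seq A).
Variables (n : nat) (x : 'I_n -> A).
Hypothesis gens : forall a, gen_by s a.
Hypothesis sx : forall a, a \in s -> exists i, a = x i.
Variables (v : (A -> A) -> Prop) (hv : lie_subalgebra v).
Hypothesis hloc : forall i : nat,
  set_dim_le (fun pt => is_point pt /\ eval_dim_le v pt i) i.
Local Notation R := {mpoly k[n + n]}.
Local Notation cX i := ('X_(lshift n i) : R).
Local Notation sX i := ('X_(rshift n i) : R).

Lemma xonly_lift a : exists p, xonly p /\ proj x p = a.
Proof.
elim: {a}(gens a) => [c|a /sx[i ->]|a b _ [p [px <-]] _ [q [qx <-]]|
                      a b _ [p [px <-]] _ [q [qx <-]]].
- exists c%:MP; split; first exact: xonlyC.
  by rewrite -alg_mpolyC projZ rmorph1.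
- by exists (cX i); split; [exact: xonly_cX|exact: proj_cX].
- by exists (p + q); split; [exact: supportedD|rewrite rmorphD].
- by exists (p * q); split; [exact: xonlyM|rewrite rmorphM].
Qed.

Section Contraction.
Variables (Q : R -> Prop) (prQ : prime_ideal Q).
Hypothesis JQ : forall p, symbol_ideal x v p -> Q p.

Definition contraction a := exists p, [/\ xonly p, proj x p = a & Q p].

(** Two lifts of an element differ by an equation of [A], which lies in the symbol ideal and hence
    in [Q]. *)
Lemma contractionP p : xonly p -> contraction (proj x p) <-> Q p.
Proof.
move=> px; split=> [[q [qx qE Qq]]|Qp]; last by exists p.
have [_ QD _ _ _] := prQ.
rewrite -(subrK q p); apply: (QD) => //; apply: JQ.
rewrite -(mul1r (p - q)); apply: symbol_ideal_ker.
  by apply: supportedD => //; apply: supportedN.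
by rewrite rmorphB /= qE subrr.
Qed.

Lemma prime_contraction : prime_ideal contraction.
Proof.
have [Q0 QD QM Q1 Qpr] := prQ; split.
- by exists 0; split; [exact: supported0|rewrite rmorph0|].
- move=> _ _ [p [px <- Qp]] [q [qx <- Qq]]; exists (p + q).
  by split; [exact: supportedD|rewrite rmorphD|exact: QD].
- move=> a _ [q [qx <- Qq]]; have [p [px <-]] := xonly_lift a.
  by exists (p * q); split; [exact: xonlyM|rewrite rmorphM|exact: QM].
- rewrite -(rmorph1 (proj x)) => /contractionP; rewrite -mpolyC1 => Q1'.
  by apply: Q1; rewrite -mpolyC1; apply/Q1'/xonlyC.
- move=> a b; have [p [px <-]] := xonly_lift a; have [q [qx <-]] := xonly_lift b.
  rewrite -rmorphM => /(contractionP (xonlyM px qx)).1 /Qpr.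
  by case=> h; [left|right]; apply/contractionP.
Qed.

(** [r] is the generic rank of [v] over the contracted prime. Bordered minors of size [r.+1] lie in
    that prime, and their expansion is the last clause. *)
Lemma maximal_minor : exists r (eta : 'I_r -> A -> A) (idx : 'I_r -> 'I_n),
  let Delta := \det (\matrix_(m < r, l < r) eta l (x (idx m))) in
  [/\ forall l, v (eta l), injective idx, ~ contraction Delta &
    forall xi, v xi -> exists a : 'I_r -> A, forall i,
      contraction (xi (x i) * Delta + \sum_l eta l (x i) * a l)].
Proof.
have [P0 PD PM P1 Ppr] := prime_contraction.
pose good r := exists (eta : 'I_r -> A -> A) (idx : 'I_r -> 'I_n),
  (forall l, v (eta l)) /\
  ~ contraction (\det (\matrix_(m < r, l < r) eta l (x (idx m)))).
have goodI r (eta : 'I_r -> A -> A) (idx : 'I_r -> 'I_n) :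
    ~ contraction (\det (\matrix_(m < r, l < r) eta l (x (idx m)))) -> injective idx.
  move=> nP m1 m2 e; apply/eqP; apply: boolp.contrapT => /negP m12; apply: nP.
  by rewrite (determinant_alternate m12) // => l; rewrite !mxE e.
(* A minor outside the prime has distinct rows, so its size is at most [n] and some good size has a
   successor that is not good. *)
have [r [[eta [idx [veta nP]]] ngood]] : exists r, good r /\ ~ good r.+1.
  apply: boolp.contrapT => nex.
  suff gr r : good r.
    have [eta [idx [_ /goodI idxI]]] := gr n.+1.
    by have := leq_card _ idxI; rewrite !card_ord ltnn.
  elim: r => [|r gr].
    by exists (fun _ => id), (widen_ord (leq0n n)); split; [case|rewrite det_mx00].
  by apply: boolp.contrapT => ng; apply: nex; exists r.
exists r, eta, idx; split=> //; first exact: goodI nP.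
move=> xi vxi.
have [a aE] := bordered_det (fun i l => eta l (x i)) (fun i => xi (x i)) idx.
exists a => i; rewrite -aE; apply: boolp.contrapT => nPi; apply: ngood.
exists (fun l => if unlift ord_max l is Some l0 then eta l0 else xi),
       (fun m => if unlift ord_max m is Some m0 then idx m0 else i); split.
  by move=> l; case: unlift.
move=> h; apply: nPi; move: h; congr contraction; congr (\det _).
by apply/matrixP => m l; rewrite !mxE; case: (unlift _ l).
Qed.

(** At points over the contracted prime with [Delta] nonzero, [v] has rank at most [r]. So if [f]
    vanishes where the rank is at most [r], then [f * Delta] vanishes at every point over the prime,
    and [f] lies in it. The hypothesis on loci thus excludes a chain of length [r.+1] above it,
    which independent coordinates in [T] would produce. *)
Lemma algebraic_relation r (eta : 'I_r -> A -> A) (idx : 'I_r -> 'I_n)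
    (Delta := \det (\matrix_(m < r, l < r) eta l (x (idx m)))) (T : {set 'I_(n + n)}) :
  (forall l, v (eta l)) -> ~ contraction Delta ->
  (forall xi, v xi -> exists a : 'I_r -> A, forall i,
      contraction (xi (x i) * Delta + \sum_l eta l (x i) * a l)) ->
  #|T| = r.+1 -> (forall i, i \in T -> exists j, i = lshift n j) ->
  exists f, [/\ f != 0, Q f & supported (vars_in T) f].
Proof.
move=> veta nP cram cT Tl.
have prP := prime_contraction; have [P0 PD PM P1 Ppr] := prP.
have hft : finite_type A by exists s.
have [vder _ _ _ _] := hv.
have rank_pt pt : is_point pt -> (forall a, contraction a -> pt a = 0) ->
    pt Delta <> 0 -> eval_dim_le v pt r.
  move=> ispt ptP /eqP ptD; have [pD pM pZ p1] := ispt.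
  have pt0 : pt 0 = 0 by have := pZ 0 0; rewrite scale0r mul0r.
  exists eta; split=> // xi vxi; have [a aP] := cram xi vxi.
  (* Cramer's rule: the relations of [cram], evaluated at [pt] and divided by [pt Delta]. *)
  exists (fun l => - (pt (a l) / pt Delta)) => f.
  apply: (point_derivation_span ispt (vder _ vxi) _ sx) (gens f).
    by move=> l; apply: vder.
  move=> i; have := ptP _ (aP i); rewrite pD pM.
  have -> : pt (\sum_l eta l (x i) * a l) = \sum_l pt (eta l (x i)) * pt (a l).
    by elim/big_rec2: _ => // l y1 y2 _ <-; rewrite pD pM.
  move/eqP; rewrite addr_eq0 => /eqP e.
  apply: (mulIf ptD); rewrite e mulr_suml -sumrN; apply: eq_bigr => l _.
  by field.
have vanP f : vanishing_ideal (fun pt => is_point pt /\ eval_dim_le v pt r) f ->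
    contraction f.
  move=> van; apply: boolp.contrapT => nPf.
  have [|pt [ispt ptP ptf]] := @nullstellensatz k A hft contraction (f * Delta) prP.
    by case/Ppr.
  have [pD pM pZ p1] := ispt; apply: ptf; rewrite pM.
  have [->|/eqP d0] := eqVneq (pt Delta) 0; first by rewrite mulr0.
  by rewrite van ?mul0r //; split=> //; apply: rank_pt.
have [t0 t0T] : exists t0, t0 \in T by apply/set0Pn; rewrite -card_gt0 cT.
pose i m := nth t0 (enum T) m.
(* The second branch is a default: for [m < r.+1] only coordinates occur. *)
pose j m := match split (i m) with inl a => a | inr a => a end.
have ij m : (m < r.+1)%N -> i m = lshift n (j m).
  move=> mr; have /Tl[a aE] : i m \in T.
    by rewrite -mem_enum mem_nth // -cardE cT.
  by rewrite /j aE -[lshift _ a]/(unsplit (inl a)) unsplitK.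
pose ev := tower_eval (fun m => cX (j m)) r.+1.
have projE c : proj x (ev c) = tower_eval (fun m => x (j m)) r.+1 c.
  rewrite tower_eval_rmorph => [|a]; last by rewrite projZ rmorph1.
  by congr (tower_eval _ _ _); apply: boolp.funext => m /=; rewrite proj_cX.
apply: boolp.contrapT => nex.
have [|p [Pp0 pprime pS]] := @prime_chain k A (fun m => x (j m)) r.+1 contraction hft prP.
  move=> c c0; rewrite -projE => Pc; apply: nex.
  have sup := @tower_eval_supported k (n + n) (fun m => lshift n (j m)) r.+1 c.
  have supT : supported (vars_in T) (ev c).
    apply: supported_sub sup => m hm l lT; apply: hm; apply: contra lT.
    case/imsetP => m0 _ ->; have <- := ij _ (ltn_ord m0).
    by rewrite -mem_enum mem_nth // -cardE cT.
  exists (ev c); split=> //.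
    apply: contra_neq c0; apply: (@tower_eval_inj k (n + n) (fun m => lshift n (j m))).
    move=> j1 j2 l1 l2; rewrite -!ij // => /eqP; rewrite nth_uniq ?enum_uniq -?cardE ?cT //.
    by move/eqP.
  apply/contractionP => //.
  apply: supported_sub supT => m hm; rewrite /sdeg big1 // => a _; apply: hm.
  by apply/negP => /Tl[b /eqP]; rewrite eq_rlshift.
have pP l : (l <= r.+1)%N -> forall f, contraction f -> p l f.
  elim: l => [_|l IH lr f Pf]; first exact: Pp0.
  by have [sub _] := pS l lr; apply/sub/IH => //; apply: ltnW.
have := @hloc r r.+1 p; rewrite ltnn => h; suff: false by [].
apply: h => // l lr; split; first exact: pprime.
by move=> f /vanP; apply: pP.
Qed.

Definition symbol_free r (idx : 'I_r -> 'I_n) (m : 'X_{1..n + n}) :=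
  forall i, m (rshift n (idx i)) = 0%N.

Lemma symbol_freeD r (idx : 'I_r -> 'I_n) m1 m2 :
  symbol_free idx m1 -> symbol_free idx m2 -> symbol_free idx (m1 + m2)%MM.
Proof. by move=> h1 h2 i; rewrite mnmDE h1 h2. Qed.

Lemma xonly_free r (idx : 'I_r -> 'I_n) (p : R) :
  xonly p -> supported (symbol_free idx) p.
Proof.
apply: supported_sub => m m0 i; apply/eqP; rewrite -leqn0 -m0.
by rewrite /sdeg (bigD1 (idx i)) //= leq_addr.
Qed.

(** Modulo [Q] the symbols of the lifted fields vanish. The adjugate solves this linear system for
    [d] times a symbol indexed by [idx], in terms of the other symbols. *)
Lemma symbol_elimination r (eta : 'I_r -> A -> A) (idx : 'I_r -> 'I_n)
    (Delta := \det (\matrix_(m < r, l < r) eta l (x (idx m)))) :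
  (forall l, v (eta l)) -> injective idx -> ~ contraction Delta ->
  exists (d : R) (delta : nat),
    [/\ ~ Q d, supported (fun m => symbol_free idx m /\ (mdeg m <= delta)%N) d &
        forall l, exists b, Q (d * 'X_l - b) /\
          supported (fun m => symbol_free idx m /\ (mdeg m <= delta)%N) b].
Proof.
move=> veta idxI nP; have [Q0 QD QM Q1 Qpr] := prQ.
have [hh hhP] : exists hh : 'I_r -> 'I_n -> R, forall l i,
    xonly (hh l i) /\ proj x (hh l i) = eta l (x i).
  have [hh hhP] := boolp.choice (fun li : 'I_r * 'I_n => xonly_lift (eta li.1 (x li.2))).
  by exists (fun l i => hh (l, i)) => l i; have := hhP (l, i).
pose B := \matrix_(m < r, l < r) hh l (idx m).
pose d := \det B.
have dx : xonly d by apply: xonly_det => m l; rewrite mxE; have [] := hhP l (idx m).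
have nQd : ~ Q d.
  move/(contractionP dx); apply: contra_not nP; congr contraction.
  rewrite -det_map_mx; congr (\det _); apply/matrixP => m l; rewrite !mxE.
  by have [_ ->] := hhP l (idx m).
have dfree := xonly_free idx dx.
have step l : exists b, Q (d * 'X_l - b) /\ supported (symbol_free idx) b.
  have trivial_step : symbol_free idx U_(l)%MM ->
      exists b, Q (d * 'X_l - b) /\ supported (symbol_free idx) b.
    move=> lf; exists (d * 'X_l); rewrite subrr; split=> //.
    by apply: supportedM dfree (supportedX lf); apply: symbol_freeD.
  case: (split_ordP l) => i lE.
    by apply: trivial_step => j; rewrite lE mnm1E eq_lrshift.
  case: (boolP (i \in [set idx m | m : 'I_r])) => [/imsetP[m0 _ iE]|iN]; last first.
    apply: trivial_step => j; rewrite lE mnm1E (inj_eq (@rshift_inj _ _)).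
    by case: eqP => // e; rewrite e imset_f in iN.
  (* Coefficient of [sX i] in the combination of the symbols by a column of the adjugate: [d] at
     [idx m0] and 0 at the other [idx m]. *)
  pose col i := \sum_l hh l i * (\adj B) l m0.
  exists (- \sum_(i | i \notin [set idx m | m : 'I_r]) sX i * col i); split; last first.
    apply: supportedN; apply: supported_sum => j jN.
    apply: (@supportedM _ _ (symbol_free idx) (symbol_free idx)).
    - exact: symbol_freeD.
    - apply: supportedX => m; rewrite mnm1E (inj_eq (@rshift_inj _ _)).
      by case: eqP => // e; rewrite e imset_f in jN.
    - apply: xonly_free; apply: supported_sum => l0 _; apply: xonlyM.
        by have [] := hhP l0 j.
      rewrite mxE; apply: xonlyM; last first.
        by apply: xonly_det => a c; rewrite !mxE; exact: (hhP _ _).1.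
      rewrite -signr_odd; case: odd; rewrite ?expr1 ?expr0.
        by apply: supportedN; rewrite -mpolyC1; apply: xonlyC.
      by rewrite -mpolyC1; apply: xonlyC.
  suff -> : d * 'X_l - - \sum_(i | i \notin [set idx m | m : 'I_r]) sX i * col i =
      \sum_l0 (\adj B) l0 m0 * symbol (hh l0).
    apply: (big_ind Q) => // l0 _; apply: JQ; apply: symbol_ideal_vfield.
    by exists (eta l0) => // j; exact: hhP.
  transitivity (\sum_i sX i * col i).
    rewrite opprK [RHS](bigID (mem [set idx m | m : 'I_r])) /=; congr (_ + _).
    rewrite big_imset /=; last by move=> ? ? _ _; apply: idxI.
    rewrite (bigD1 m0) //= big1 ?addr0 => [|m mm0].
      rewrite lE iE mulrC; congr (_ * _).
      have /matrixP/(_ m0 m0) := mul_mx_adj B; rewrite !mxE eqxx mulr1n -/d => <-.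
      by apply: eq_bigr => l0 _; rewrite mxE.
    have /matrixP/(_ m m0) := mul_mx_adj B; rewrite !mxE (negPf mm0) mulr0n => e.
    suff -> : col (idx m) = 0 by rewrite mulr0.
    rewrite -[RHS]e.
    apply: eq_bigr => l0 _.
    by rewrite [B _ _]mxE.
  rewrite /col; under eq_bigr do rewrite mulr_sumr.
  rewrite exchange_big /=; apply: eq_bigr => l0 _; rewrite /symbol mulr_sumr.
  apply: eq_bigr => j _; move: (sX j) (hh l0 j) ((\adj B) l0 m0) => a1 a2 a3.
  by rewrite mulrCA mulrA mulrC.
have [b bP] := boolp.choice step.
exists d, (maxn (msize d) (\max_l msize (b l))); split=> //.
  move=> m md; split; first exact: dfree.
  by apply: leq_trans (leq_maxl _ _); apply: ltnW; apply: msize_mdeg_lt.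
move=> l; exists (b l); have [Qb sb] := bP l; split=> // m mb; split; first exact: sb.
apply: leq_trans (leq_maxr _ _); apply: leq_trans (_ : msize (b l) <= _)%N.
  by apply: ltnW; apply: msize_mdeg_lt.
exact: (bigmax_sup l).
Qed.

(** One factor [d] is spent on each variable of the monomial. Since [d] is itself free of the
    eliminated symbols, surplus factors do no harm, and one exponent [sg] serves all monomials. *)
Lemma power_reducible r (idx : 'I_r -> 'I_n) (d : R) delta sg (m : 'X_{1..n + n}) :
  supported (fun m => symbol_free idx m /\ (mdeg m <= delta)%N) d ->
  (forall l, exists b, Q (d * 'X_l - b) /\
     supported (fun m => symbol_free idx m /\ (mdeg m <= delta)%N) b) ->
  (mdeg m <= sg)%N ->
  exists q, Q (d ^+ sg * 'X_[m] - q) /\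
    supported (fun m => symbol_free idx m /\ (mdeg m <= delta * sg)%N) q.
Proof.
move=> sd sb; have [Q0 QD QM Q1 Qpr] := prQ.
have supM (p q : R) a : supported (fun m => symbol_free idx m /\ (mdeg m <= delta)%N) p ->
    supported (fun m => symbol_free idx m /\ (mdeg m <= delta * a)%N) q ->
    supported (fun m => symbol_free idx m /\ (mdeg m <= delta * a.+1)%N) (p * q).
  apply: supportedM => m1 m2 [h1 h2] [h3 h4]; split; first exact: symbol_freeD.
  by rewrite mdegD mulnS leq_add.
elim: sg m => [|sg IH] m.
  rewrite leqn0 mdeg_eq0 => /eqP->; exists 1; rewrite expr0 mpolyX0 mulr1 subrr.
  split=> //; rewrite -mpolyX0; apply: supportedX; rewrite mdeg0; split=> // i.
  by rewrite mnm0E.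
have [->|m0] := eqVneq m 0%MM => ms.
  have [|q [Qq sq]] := IH 0%MM; first by rewrite mdeg0.
  exists (d * q); split; last exact: supM.
  have -> : d ^+ sg.+1 * 'X_[0] - d * q = d * (d ^+ sg * 'X_[0] - q).
    by rewrite exprS mulrBr mulrA.
  exact: QM.
have [l ml] : exists l, m l != 0%N.
  apply/existsP; apply: contraNT m0; rewrite negb_exists => /forallP mz.
  by apply/eqP/mnmP => l; rewrite mnm0E; apply/eqP; rewrite -[_ == _]negbK.
have mE : m = ((m - U_(l)) + U_(l))%MM by rewrite submK // lep1mP.
have [|q [Qq sq]] := IH (m - U_(l))%MM.
  by move: ms; rewrite {1}mE mdegD mdeg1 addn1.
have [b [Qb sbl]] := sb l.
exists (b * q); split; last exact: supM.
have -> : d ^+ sg.+1 * 'X_[m] - b * q =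
    b * (d ^+ sg * 'X_[(m - U_(l))] - q) + (d ^+ sg * 'X_[(m - U_(l))]) * (d * 'X_l - b).
  rewrite {1}mE mpolyXD exprS; move: (d ^+ sg) 'X_[(m - U_(l))] 'X_l => e1 e2 e3; ring.
by apply: (QD); apply: QM.
Qed.

(* Otherwise [t.+1 ^ n.+1] monomials in [U], after multiplication by a power of the
   minor [d], would fit in a space whose dimension grows like [t ^ n]. *)
Lemma prime_meets_vars (U : {set 'I_(n + n)}) : #|U| = n.+1 ->
  ~ (forall p, p != 0 -> supported (vars_in U) p -> ~ Q p).
Proof.
move=> cU avoid; have [Q0 QD QM Q1 Qpr] := prQ.
have [r [eta [idx [veta idxI nP cram]]]] := maximal_minor.
have [d [delta [nQd sd sb]]] := symbol_elimination veta idxI nP.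
have rel (T : {set 'I_(n + n)}) : exists f, #|T| = r.+1 ->
    (forall i, i \in T -> exists j, i = lshift n j) ->
    [/\ f != 0, Q f & supported (vars_in T) f].
  case: (boolp.EM (#|T| = r.+1 /\ (forall i, i \in T -> exists j, i = lshift n j))).
    by case=> cT Tl; have [f fP] := algebraic_relation veta nP cram cT Tl; exists f.
  by move=> h; exists 0 => cT Tl; case: h.
have [f fP] := boolp.choice rel.
pose e := (\max_T mdeg (mlead (f T))).+1.
have subQ : subspace Q.
  by split=> // c a Qa; rewrite -mul_mpolyC; apply: QM.
have mdeg_ge (m : 'X_{1..n + n}) i : (m i <= mdeg m)%N.
  by rewrite mdegE (bigD1 i) //= leq_addr.
have [|C CP] := @growth_bound k (n + n) Q subQ (symbol_free idx) (fun m => mdeg m) n e mdeg_ge.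
  move=> m mf mL; set L := large_set e m in mL.
  (* A monomial without the symbols in [idx] involves at most [n - r] symbols, so at least [r.+1] of
     its large exponents belong to coordinates. *)
  have [T TL cT] : exists2 T : {set 'I_(n + n)},
      T \subset L :&: [set lshift n i | i : 'I_n] & #|T| = r.+1.
    apply: exists_subset_card.
    have LR : L :\: [set lshift n i | i : 'I_n] \subset
              [set rshift n i | i in ~: [set idx j | j : 'I_r]].
      apply/subsetP => i; rewrite !inE => /andP[il iL].
      case: (split_ordP i) => j ij; first by rewrite ij imset_f in il.
      rewrite ij; apply: imset_f; rewrite inE; apply/negP => /imsetP[a _ ja].
      by move: iL; rewrite ij ja mf.
    have := subset_leq_card LR; rewrite card_imset; last exact: rshift_inj.
    have cI : #|[set idx j | j : 'I_r]| = r by rewrite card_imset // card_ord.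
    have := cardsC [set idx j | j : 'I_r]; rewrite cI card_ord.
    have := cardsID [set lshift n i | i : 'I_n] L;    move=> cL h2 h3; move: mL; rewrite -cL => h1.
    rewrite -(leq_add2r #|L :\: [set lshift n i | i : 'I_n]|).
    apply: leq_trans h1; rewrite addSn ltnS -[X in (_ <= X)%N]h2 leq_add2l.
    exact: h3.
  have [|f0 Qf fT] := fP T cT.
    move=> i /(subsetP TL); rewrite inE => /andP[_ /imsetP[j _ ->]]; by exists j.
  move: f0 Qf fT; set g := f T => f0 Qf fT.
  have gx : xonly g.
    apply: supported_sub fT => a ha; rewrite /sdeg big1 // => i _; apply: ha.
    apply/negP => /(subsetP TL); rewrite inE => /andP[_ /imsetP[j _ /eqP]].
    by rewrite eq_rlshift.
  have gm : (mlead g <= m)%MM.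
    apply: (@mlead_le_large _ _ _ e _ T) => //.
      by rewrite /e ltnS; apply: (bigmax_sup T).
    exact: subset_trans TL (subsetIl _ _).
  set l := mlead g in gm.
  pose m' := (m - l)%MM; have mE : m = (m' + l)%MM by rewrite submK.
  pose c := g@_l; have c0 : c != 0 by rewrite mleadc_eq0.
  exists ('X_[m'] * ('X_[l] - c^-1 *: g)); split.
    have -> : 'X_[m] - 'X_[m'] * ('X_[l] - c^-1 *: g) = (c^-1%:MP * 'X_[m']) * g.
      by rewrite {1}mE mpolyXD mulrBr opprB addrC subrK mul_mpolyC -scalerAr scalerAl.
    exact: QM.
  apply: (@supportedM _ _ (fun a => a = m') (fun a => a \in msupp g /\ a != l)).
  - move=> m1 a -> [ag al]; split.
      move=> i; rewrite mnmDE mnmBE mf sub0n add0n.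
      exact: (xonly_free idx gx ag).
    right; have ale := msupp_le_mlead ag; split.
      by rewrite mE !mdegD leq_add2l; apply: lemc_mdeg.
    by rewrite mE ltmc_add2r Order.POrderTheory.lt_neqAle al.
  - exact: supportedX.
  - move=> a; rewrite mcoeff_msupp mcoeffB mcoeffZ mcoeffX eq_sym => ha.
    case: (eqVneq a l) ha => [->|al] ha.
      by rewrite mulVf // subrr eqxx in ha.
    split=> //; rewrite mcoeff_msupp; apply: contraNneq ha => ->.
    by rewrite mulr0 subr0.
(* [sg] bounds the degree of monomials with exponents at most [t]. As [(delta * sg).+1] is at most
   [(delta * (n + n)).+1 * t.+1], the bound [C * (delta * sg).+1 ^ n] is at most [t * t.+1 ^ n],
   less than the number of such monomials in [U]. *)
pose t := (C * (delta * (n + n)).+1 ^ n)%N.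
pose sg := ((n + n) * t)%N.
pose I : finType := {ffun 'I_(n + n) -> 'I_t.+1}.
pose PU := pffun_on (ord0 : 'I_t.+1) U predT.
pose J : finType := {g : I | g \in PU}.
pose mon (g : J) : 'X_{1..n + n} := [multinom val (val g i) | i < n + n].
have mon_inj : injective mon.
  move=> g1 g2 /mnmP e12; apply: val_inj; apply/ffunP => i; apply: val_inj.
  by have := e12 i; rewrite !mnmE.
have monU g : vars_in U (mon g).
  move=> i iU; rewrite mnmE; have /pffun_onP[sup _] := valP g.
  by rewrite (supportP sup i iU).
have cJ : #|J| = (t.+1 ^ n.+1)%N.
  by rewrite card_sig card_pffun_on cU /= cardT size_enum_ord.
have mon_deg g : (mdeg (mon g) <= sg)%N.
  rewrite mdegE /sg -[X in (_ <= X * _)%N](card_ord (n + n)) -sum_nat_const.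
  by apply: leq_sum => i _; rewrite mnmE -ltnS ltn_ord.
have [||c [[g cg] Qc]] := CP (delta * sg)%N J (fun g => d ^+ sg * 'X_[mon g]).
- by move=> g; apply: power_reducible.
- rewrite cJ expnS; apply: leq_ltn_trans (_ : t * t.+1 ^ n < _)%N; last first.
    by rewrite ltn_pmul2r // expn_gt0.
  rewrite {1}/t -mulnA leq_mul2l -expnMn; apply/orP; right.
  have mono a b : (a <= b)%N -> (a ^ n <= b ^ n)%N.
    by move=> ab; case: (posnP n) => [->|n0]; rewrite ?expn0 ?leq_exp2r.
  apply: mono; rewrite /sg; move: (t) (n + n)%N => t1 n1; nia.
pose p := \sum_g c g *: 'X_[mon g] : R.
have Qp : Q p.
  have : Q (d ^+ sg * p).
    move: Qc; congr Q; rewrite /p mulr_sumr; apply: eq_bigr => g0 _.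
    by rewrite scalerAr.
  (* [Q] is prime and does not contain [d], so the power of [d] cancels. *)
  by case/Qpr => // /(prime_powers prQ nQd).
apply: (avoid p) Qp.
  apply: contraNneq cg => p0.
  have : p@_(mon g) = c g.
    rewrite /p raddf_sum (bigD1 g) //= mcoeffZ mcoeffX eqxx mulr1 big1 ?addr0 // => g1 g1g.
    by rewrite mcoeffZ mcoeffX (inj_eq mon_inj) (negPf g1g) mulr0.
  by rewrite p0 mcoeff0 => <-.
by apply: supported_sum => g0 _; apply: supportedZ; apply: supportedX.
Qed.

End Contraction.
(** Otherwise the symbol ideal avoids the multiplicative set of nonzero polynomials in [U], and so
    does some prime above it, against [prime_meets_vars]. *)
Lemma eliminants (U : {set 'I_(n + n)}) : #|U| = n.+1 ->
  exists p, [/\ p != 0, symbol_ideal x v p & supported (vars_in U) p].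
Proof.
move=> cU; apply: boolp.contrapT => nex.
have [|||Q [prQ JQ QS _]] := @prime_avoiding k R (symbol_ideal x v)
  (fun p => p != 0 /\ supported (vars_in U) p) (symbol_ideal_is_ideal x v).
- split; first exact: oner_neq0.
  by rewrite -mpolyX0; apply: supportedX => i _; rewrite mnm0E.
- move=> p q [p0 sp] [q0 sq]; split; first exact: mulf_neq0.
  by apply: supportedM sp sq; apply: vars_inD.
- by move=> p Jp [p0 sp]; apply: nex; exists p.
apply: (prime_meets_vars prQ JQ cU) => p p0 sp Qp.
exact: QS Qp (conj p0 sp).
Qed.

End Eliminants.

(** * Application to a finite family of generators of [A] *)

Theorem theorem1p1 (k : closedFieldType) (A : comAlgType k)
  (hchar : [pchar k] =i pred0) (hft : finite_type A)
  (v : (A -> A) -> Prop) (hv : lie_subalgebra v)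
  (hloc : forall i : nat,
     set_dim_le (fun x => is_point x /\ eval_dim_le v x i) i) :
  coinvariants_findim v.
Proof.
have [s gens] := hft.
have sx a : a \in s -> exists i : 'I_(size s), a = s`_i.
  by move=> /(nthP 0)[i is_ <-]; exists (Ordinal is_).
apply: (@coinvariants_findim_of_eliminants k A (size s) (fun i => s`_i)) => //.
  exact: (xonly_lift gens sx).
exact: (eliminants gens sx hv hloc).
Qed.
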